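(* Let $X$ be an open set in $\mathbb{R}^n$, let $0\le q<p\le\infty$, and let $T: C^p(X,E) \to C^q(Y,F)$ be a continuous, separating, nowhere trivial linear operator with support map $h=(h_1,\dots,h_n):Y\to X$ and associated maps $\Phi_k$. For $1\le i\le n$ let $U_i$ be a dense open subset of $Y$ such that for all $y_0\in U_i$ there exist an integer $m_0\ge0$ and an open neighborhood $V$ of $y_0$ with: $\Phi_{|\lambda|}(y,S_{\lambda,u})=0$ whenever $y\in V$, $u\in E$ and $\lambda$ is a multiindex with $|\lambda|\in\mathbb{N}_p$ and $\lambda_i>m_0$; and $\Phi_{|\mu|}(y_0,S_{\mu,u})\ne0$ for some multiindex $\mu$ with $|\mu|\in\mathbb{N}_p$ and $\mu_i=m_0$ and some $u\in E$. Let $U=\bigcap_{i=1}^nU_i$. Then for $1\leq i \leq n$, $h_i$ is $C^q$ on the set $U_i$. Therefore, $h$ is $C^q$ on the dense open set $U$ of $Y$.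
   Context: $H,E,F$ are real Banach spaces, $G=\mathbb{R}^n$, and $Y\subseteq H$ is open. $\mathbb{N}_p=\{i\in\mathbb{N}\cup\{0\}: i\le p\}$ (all nonnegative integers if $p=\infty$). $\mathcal{S}^k(G,E)$ is the Banach space of bounded symmetric $k$-linear maps $G^k\to E$, with $\mathcal{S}^0(G,E)=E$; for $S\in\mathcal{S}^k(G,E)$ and $x\in G$, $Sx^k=S(x,\dots,x)$. $C^p(X,E)$ is the space of all $f:X\to E$ such that for all $k\in\mathbb{N}_p$ the Fréchet derivative $D^kf$ ($D^0f=f$) is a continuous function from $X$ to $\mathcal{S}^k(G,E)$; $C^p(X)=C^p(X,\mathbb{R})$. $C^p(X,E)$ carries the topology generated by the seminorms $\rho_{K,k}(f)=\sup_{x\in K}\sup_{0\le j\le k}\|D^jf(x)\|$, $K\subseteq X$ compact, $k\in\mathbb{N}_p$; similarly for $C^q(Y,F)$. Two functions are disjoint if at every point at least one of them is $0$. A map $T$ is separating if it maps disjoint functions to disjoint functions. $T$ is nowhere trivial if for every $y\in Y$ there is $f\in C^p(X,E)$ with $Tf(y)\ne0$. Support map: let $\mathbb{R}_\infty$ be the one-point compactification of $\mathbb{R}$, $i:X\to\mathbb{R}_\infty^{C^p(X)}$, $i(x)(\psi)=\psi(x)$ (a homeomorphic embedding), and let $\mathcal{A}X$ be the closure of $i(X)$. For $f\in C^p(X,E)$ let $\overline{C}(f)$ be the closure in $\mathcal{A}X$ of $i(\{x:f(x)\ne0\})$. For $y\in Y$ let $\mathcal{O}_y$ be the family of open subsets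 $W$ of $\mathcal{A}X$ for which there is $f\in C^p(X,E)$ with $Tf(y)\ne0$ and $\overline{C}(f)\subseteq W$. Then $h(y)$ is the unique point of $\bigcap\{\overline{W}^{\mathcal{A}X}:W\in\mathcal{O}_y\}$; for $T$ continuous, separating and nowhere trivial, $h(y)\in i(X)$, and $i(X)$ is identified with $X$, so that $h:Y\to X$ (a continuous map). For $k\in\mathbb{N}_p$, $y\in Y$, $S\in\mathcal{S}^k(G,E)$, let $f_{y,S}(x)=S(x-h(y))^k$ ($=S$ if $k=0$) and $\Phi_k(y,S)=\frac1{k!}(Tf_{y,S})(y)$. Then $Tf(y)=\sum_{k}\Phi_k(y,D^kf(h(y)))$ for all $f\in C^p(X,E)$, $y\in Y$, the sum being locally finite in $y$. A multiindex is an $n$-tuple $\lambda=(\lambda_1,\dots,\lambda_n)$ of nonnegative integers, $|\lambda|=\sum_i\lambda_i$, and $x^\lambda=\prod_{i=1}^nx_i^{\lambda_i}$. For $u\in E$, $S_{\lambda,u}$ is the element of $\mathcal{S}^{k}(\mathbb{R}^n,E)$, $k=|\lambda|$, with $S_{\lambda,u}x^k=x^\lambda u$. *)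

(* Defs.v *)
From HB Require Import structures.
From mathcomp Require Import all_boot all_order all_algebra all_fingroup.
From mathcomp Require Import all_classical all_reals all_analysis.
Set Implicit Arguments.
Unset Strict Implicit.
Unset Printing Implicit Defensive.
Import Order.TTheory GRing.Theory Num.Theory.
Import numFieldNormedType.Exports.
Local Open Scope classical_set_scope.
Local Open Scope ring_scope.

Section SymDef.
Context {R : realType} (k : nat) (G E : normedModType R).
Implicit Types f g : ('I_k -> G) -> E.

Definition multilinear_map f :=
  forall (v : 'I_k -> G) (i : 'I_k) (a : R) (x y : G),
    f (dfwith v i (a *: x + y)) = a *: f (dfwith v i x) + f (dfwith v i y).

Definition symmetric_map f := forall (v : 'I_k -> G) (s : 'S_k), f (v \o s) = f v.

Definition norm_bound f (M : R) :=
  0 <= M /\ forall v, `|f v| <= M * \prod_(i < k) `|v i|.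

Definition symml : {pred ('I_k -> G) -> E} :=
  mem [set f | [/\ multilinear_map f, symmetric_map f & exists M, norm_bound f M]].

(* The space S^k(G, E) of bounded symmetric k-linear maps from G^k to E.  For
   k = 0 the only argument is the empty family, so S^0(G, E) is E. *)
Record Sym := MkSym { sym_fun :> ('I_k -> G) -> E ; _ : sym_fun \in symml }.

HB.instance Definition _ := [isSub for sym_fun].
HB.instance Definition _ := gen_eqMixin Sym.
HB.instance Definition _ := [Choice of Sym by <:].

Lemma symml_submod_closed : submod_closed symml.
Proof.
split=> [|a f g].
  rewrite inE; split=> [v i a x y|v s|] /=; first by rewrite scaler0 addr0.
    by [].
  by exists 0; split=> // v; rewrite normr0 mul0r.
rewrite !inE => -[fl fs [M [M0 fM]]] [gl gs [N [N0 gN]]]; split.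
- move=> v i b x y; rewrite /= !fctE fl gl !scalerDr !scalerA.
  by rewrite (mulrC a b) addrACA.
- by move=> v s; rewrite !fctE fs gs.
- exists (`|a| * M + N); split=> [|v]; first by rewrite addr_ge0 ?mulr_ge0.
  rewrite (le_trans (ler_normD _ _))// normrZ mulrDl -mulrA.
  by rewrite lerD ?ler_wpM2l.
Qed.

HB.instance Definition _ := GRing.isSubmodClosed.Build _ _ symml symml_submod_closed.
HB.instance Definition _ := [SubChoice_isSubLmodule of Sym by <:].

Lemma symP (S T : Sym) : (forall v, S v = T v) -> S = T.
Proof. by move=> ST; apply: val_inj; apply: funext. Qed.

Lemma sym_linear (S : Sym) : multilinear_map S.
Proof. by case: S => f /=; rewrite inE => -[]. Qed.

Lemma sym_symmetric (S : Sym) : symmetric_map S.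
Proof. by case: S => f /=; rewrite inE => -[]. Qed.

Definition opnorm (S : Sym) : R := inf [set M | norm_bound S M].

Lemma opnorm_has_inf (S : Sym) : has_inf [set M | norm_bound S M].
Proof.
case: S => f /=; rewrite inE => -[_ _ [M fM]]; split; first by exists M.
by exists 0 => ? [].
Qed.

Lemma opnorm_le (S : Sym) M : norm_bound S M -> opnorm S <= M.
Proof. by move=> SM; apply: ge_inf => //; exact: (opnorm_has_inf S).2. Qed.

Lemma norm_bound_opnorm (S : Sym) : norm_bound S (opnorm S).
Proof.
have [S0 _] := opnorm_has_inf S; split.
  by apply: lb_le_inf => // ? [].
move=> v; have P0 : 0 <= \prod_(i < k) `|v i| by rewrite prodr_ge0.
have [P_eq0|P_neq0] := eqVneq (\prod_(i < k) `|v i|) 0.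
  by case: S0 => M [_ /(_ v)]; rewrite P_eq0 !mulr0.
have P_gt0 : 0 < \prod_(i < k) `|v i| by rewrite lt_neqAle eq_sym P_neq0.
rewrite -ler_pdivrMr//; apply: lb_le_inf => // M [_ /(_ v)].
by rewrite ler_pdivrMr.
Qed.

Lemma opnormD (S T : Sym) : opnorm (S + T) <= opnorm S + opnorm T.
Proof.
have [S0 SM] := norm_bound_opnorm S; have [T0 TM] := norm_bound_opnorm T.
apply: opnorm_le; split=> [|v]; first exact: addr_ge0.
by rewrite (le_trans (ler_normD _ _))// mulrDl lerD.
Qed.

Lemma opnormZ_le (a : R) (S : Sym) : opnorm (a *: S) <= `|a| * opnorm S.
Proof.
have [S0 SM] := norm_bound_opnorm S.
apply: opnorm_le; split=> [|v]; first exact: mulr_ge0.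
by rewrite normrZ -mulrA ler_wpM2l.
Qed.

Lemma opnormZ (a : R) (S : Sym) : opnorm (a *: S) = `|a| * opnorm S.
Proof.
apply/eqP; rewrite eq_le opnormZ_le/=; have [->|a0] := eqVneq a 0.
  by rewrite normr0 mul0r; have [] := norm_bound_opnorm (0 *: S).
rewrite -ler_pdivlMl ?normr_gt0// -normfV.
by rewrite (le_trans _ (opnormZ_le _ _))// scalerA mulVf// scale1r.
Qed.

Lemma opnorm0_eq0 (S : Sym) : opnorm S = 0 -> S = 0.
Proof.
move=> S0; apply: symP => v; apply/eqP; rewrite -normr_le0.
by have [_ /(_ v)] := norm_bound_opnorm S; rewrite S0 mul0r.
Qed.

HB.instance Definition _ := Lmodule_isNormed.Build R Sym opnormD opnormZ opnorm0_eq0.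

Lemma sym_normE (S : Sym) : `|S| = opnorm S. Proof. by []. Qed.

Lemma sym_addE (S T : Sym) v : (S + T) v = S v + T v. Proof. by []. Qed.

Lemma sym_scaleE a (S : Sym) v : (a *: S) v = a *: S v. Proof. by []. Qed.

Lemma sym_zeroE v : (0 : Sym) v = 0. Proof. by []. Qed.

End SymDef.
Arguments symml {R k G E}.
Arguments MkSym {R k G E} _ _.

Section SymOperations.
Context {R : realType} {G E : normedModType R}.

Lemma sym_const_subproof (u : E) : (fun _ : 'I_0 -> G => u) \in symml.
Proof.
rewrite inE; split=> [v []//|//|].
by exists `|u|; split=> // v; rewrite big_ord0 mulr1.
Qed.

Definition sym_const (u : E) : Sym 0 G E := MkSym _ (sym_const_subproof u).

Definition consf k (x : G) (v : 'I_k -> G) : 'I_k.+1 -> G :=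
  fun i => oapp v x (unlift ord0 i).

Lemma consf0 k x (v : 'I_k -> G) : consf x v ord0 = x.
Proof. by rewrite /consf unlift_none. Qed.

Lemma consfS k x (v : 'I_k -> G) i : consf x v (lift ord0 i) = v i.
Proof. by rewrite /consf liftK. Qed.

Lemma consf_dfwith k x (v : 'I_k -> G) i y :
  consf x (dfwith v i y) = dfwith (consf x v) (lift ord0 i) y.
Proof.
apply/funext => j; case: (unliftP ord0 j) => [l|] ->; last first.
  by rewrite consf0 dfwithout ?consf0// eq_sym neq_lift.
rewrite consfS; have [->|il] := eqVneq l i; first by rewrite !dfwithin.
by rewrite !dfwithout ?consfS 1?eq_sym// (inj_eq lift_inj).
Qed.

Lemma dfwith_consf k x y (v : 'I_k -> G) :
  dfwith (consf x v) ord0 y = consf y v.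
Proof.
apply/funext => j; case: (unliftP ord0 j) => [l|] ->; last first.
  by rewrite consf0 dfwithin.
by rewrite dfwithout ?neq_lift// !consfS.
Qed.

Lemma consf_prod k x (v : 'I_k -> G) :
  \prod_(i < k.+1) `|consf x v i| = `|x| * \prod_(i < k) `|v i|.
Proof. by rewrite big_ord_recl consf0; under eq_bigr do rewrite consfS. Qed.

Lemma sym_app_subproof k (S : Sym k.+1 G E) (x : G) :
  (fun v => S (consf x v)) \in symml.
Proof.
rewrite inE; split=> [v i a y z|v s|].
- by rewrite !consf_dfwith sym_linear.
- rewrite -(sym_symmetric S (consf x v) (lift_perm ord0 ord0 s)).
  congr (S _); apply/funext => j; rewrite /=.
  case: (unliftP ord0 j) => [l|] ->; last by rewrite lift_perm_id !consf0.
  by rewrite lift_perm_lift !consfS.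
- have [S0 SM] := norm_bound_opnorm S.
  exists (opnorm S * `|x|); split=> [|v]; first exact: mulr_ge0.
  by rewrite (le_trans (SM _))// consf_prod mulrA.
Qed.

(* Contraction of the first argument: S |-> (x |-> S(x, ...)) is the embedding
   of S^(k+1)(G, E) into the bounded linear maps from G to S^k(G, E). *)
Definition sym_app k (S : Sym k.+1 G E) (x : G) : Sym k G E :=
  MkSym _ (sym_app_subproof S x).

Definition sym_pow k (S : Sym k G E) (x : G) : E := S (fun=> x).

(* [frechet_deriv f k x] is D^k f (x).  Where D^k f fails to be differentiable
   at x, or its derivative at x does not lie in S^(k+1)(G, E), the default value
   0 is returned; membership in C^p excludes this case. *)
Fixpoint frechet_deriv (f : G -> E) (k : nat) : G -> Sym k G E :=
  match k return G -> Sym k G E with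
  | 0 => fun x => sym_const (f x)
  | k'.+1 => fun x =>
      xget 0 [set S | is_diff x (frechet_deriv f k') (sym_app S)]
  end.

End SymOperations.

(* Differentiability classes are indexed by [option nat], [None] being
   infinity; [le_ord k p] means that k belongs to N_p, [lt_ord k p] that
   k < p. *)
Definition le_ord (k : nat) (p : option nat) : bool :=
  if p is Some m then (k <= m)%N else true.

Definition lt_ord (k : nat) (p : option nat) : bool :=
  if p is Some m then (k < m)%N else true.

Lemma le_ordW k p : le_ord k.+1 p -> le_ord k p.
Proof. by case: p => //= m; exact: ltnW. Qed.

Section IsCp.
Context {R : realType} {G E : normedModType R}.
Implicit Types (f g : G -> E) (p : option nat) (X : set G).

(* Used for open X only, where the derivatives at points of X do not depend on
   the values of f outside X. *)
Definition is_Cp p X f :=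
  (forall k, le_ord k.+1 p -> forall x, X x ->
     is_diff x (frechet_deriv f k) (sym_app (frechet_deriv f k.+1 x))) /\
  (forall k, le_ord k p -> {within X, continuous (frechet_deriv f k)}).

Lemma near_is_diff (V W : normedModType R) (a b da : V -> W) x :
  {near x, a =1 b} -> is_diff x a da -> is_diff x b da.
Proof.
move=> ab [dfa <-].
have abx : a x = b x by exact: nbhs_singleton ab.
have dac : continuous ('d a x) by exact: diff_continuous.
have bE : b \o shift x = cst (b x) + 'd a x +o_ (0 : V) id.
  apply/eqaddoP => e e0.
  have /eqaddoP/(_ e e0) := diff_locally dfa.
  have : \forall h \near 0, a (h + x) = b (h + x).
    have /= H := near_shift 0 x (fun y => a y = b y).
    move: ab; rewrite /prop_near1 in H *; rewrite H.
    by apply: filterS => y /=; rewrite subr0.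
  by apply: filterS2 => h /= abh; rewrite !fctE /= abh abx.
have dE := diff_unique dac bE.
by split=> //; apply/diff_locallyP; rewrite dE.
Qed.

Lemma sym_app_inj k : injective (@sym_app R G E k).
Proof.
move=> S T ST; apply: symP => v.
have -> : v = consf (v ord0) (v \o lift ord0).
  apply/funext => j; case: (unliftP ord0 j) => [l|] ->; first by rewrite consfS.
  by rewrite consf0.
exact: (congr1 (fun F : G -> Sym k G E => F (v ord0) (v \o lift ord0)) ST).
Qed.

Lemma frechet_deriv_eq f k x (S : Sym k.+1 G E) :
  is_diff x (frechet_deriv f k) (sym_app S) -> frechet_deriv f k.+1 x = S.
Proof.
move=> dS; apply: xget_unique => // T dT; apply: sym_app_inj.
by rewrite -(@diff_val _ _ _ _ _ _ _ dS) -(@diff_val _ _ _ _ _ _ _ dT).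
Qed.

Lemma frechet_deriv_eq_on X f g : open X -> (forall x, X x -> f x = g x) ->
  forall k x, X x -> frechet_deriv f k x = frechet_deriv g k x.
Proof.
move=> oX fg; elim=> [|k IH] x Xx; first by rewrite /= fg.
rewrite /=; congr xget; apply/seteqP.
have near_fg : {near x, frechet_deriv f k =1 frechet_deriv g k}.
  by near=> y; apply: IH; near: y; exact: open_nbhs_nbhs.
have near_gf : {near x, frechet_deriv g k =1 frechet_deriv f k}.
  by near=> y; apply/esym/IH; near: y; exact: open_nbhs_nbhs.
by split=> S /=; apply: near_is_diff.
Unshelve. all: by end_near. Qed.

Lemma is_Cp_eq p X f g : open X -> (forall x, X x -> f x = g x) ->
  is_Cp p X f -> is_Cp p X g.
Proof.
move=> oX fg [df cf]; have Dfg := frechet_deriv_eq_on oX fg.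
split=> k kp.
  move=> x Xx; rewrite -Dfg//; apply: (near_is_diff _ (df _ kp x Xx)).
  by near=> y; apply: Dfg; near: y; exact: open_nbhs_nbhs.
apply: (@subspace_eq_continuous _ X _ (frechet_deriv f k)) (cf _ kp) => x.
by move=> /set_mem Xx; exact: Dfg.
Unshelve. all: by end_near. Qed.

Lemma frechet_deriv_cst0 k : frechet_deriv (0 : G -> E) k = 0.
Proof.
elim: k => [|k IH]; apply/funext => x; first by apply: symP.
apply: frechet_deriv_eq; rewrite IH.
have -> : sym_app (0 : Sym k.+1 G E) = 0 by apply/funext => y; apply: symP.
exact: is_diff_cst.
Qed.

Lemma frechet_deriv_linear p X f g a : open X -> is_Cp p X f -> is_Cp p X g ->
  forall k, le_ord k p -> forall x, X x ->
  frechet_deriv (a *: f + g) k x = a *: frechet_deriv f k x + frechet_deriv g k x.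
Proof.
move=> oX [df _] [dg _]; elim=> [|k IH] kp x Xx; first exact: symP.
apply: frechet_deriv_eq.
have -> : sym_app (a *: frechet_deriv f k.+1 x + frechet_deriv g k.+1 x) =
    a *: sym_app (frechet_deriv f k.+1 x) + sym_app (frechet_deriv g k.+1 x).
  by apply/funext => y; apply: symP.
have := is_diffD (is_diffZ a (df _ kp x Xx)) (dg _ kp x Xx).
apply: near_is_diff; near=> y; rewrite [RHS]IH//; first exact: le_ordW.
by near: y; exact: open_nbhs_nbhs.
Unshelve. all: by end_near. Qed.

Lemma is_Cp_linear p X f g a : open X -> is_Cp p X f -> is_Cp p X g ->
  is_Cp p X (a *: f + g).
Proof.
move=> oX Cf Cg; have L := frechet_deriv_linear a oX Cf Cg.
have [df cf] := Cf; have [dg cg] := Cg; split=> k kp.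
  move=> x Xx; rewrite L//.
  have -> : sym_app (a *: frechet_deriv f k.+1 x + frechet_deriv g k.+1 x) =
      a *: sym_app (frechet_deriv f k.+1 x) + sym_app (frechet_deriv g k.+1 x).
    by apply/funext => y; apply: symP.
  have := is_diffD (is_diffZ a (df _ kp x Xx)) (dg _ kp x Xx).
  apply: near_is_diff; near=> y; rewrite [RHS]L//; first exact: le_ordW.
  by near: y; exact: open_nbhs_nbhs.
apply: (@subspace_eq_continuous _ X _
  (fun x => a *: frechet_deriv f k x + frechet_deriv g k x)).
  by move=> x /set_mem Xx; exact/esym/L.
by move=> x; apply: cvgD; [apply: cvgZr; exact: cf|exact: cg].
Unshelve. all: by end_near. Qed.

Lemma is_Cp0 p X : is_Cp p X 0.
Proof.
split=> k _; rewrite !frechet_deriv_cst0; last by move=> x; exact: cvg_cst.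
move=> x _; have -> : sym_app ((0 : G -> Sym k.+1 G E) x) = 0.
  by apply/funext => y; apply: symP.
exact: is_diff_cst.
Qed.

End IsCp.

Definition Cp_pred {R : realType} {G : normedModType R} (p : option nat)
    (X : set G) (E : normedModType R) : {pred G -> E} :=
  mem [set f | is_Cp p X f /\ forall x, ~ X x -> f x = 0].

Arguments Cp_pred {R G} p X E.

(* C^p(X, E) for an open set X: a function on X is represented by its extension
   by 0 to the whole space. *)
Record Cp {R : realType} {G : normedModType R} (p : option nat) (X : set G)
    (oX : open X) (E : normedModType R) :=
  MkCp { Cp_fun :> G -> E ; _ : Cp_fun \in Cp_pred p X E }.
Arguments MkCp {R G p X} oX {E} _ _.

Section CpStructure.
Context {R : realType} {G : normedModType R} (p : option nat) (X : set G).
Context (oX : open X) (E : normedModType R).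
Local Notation Cp := (Cp p oX E).

HB.instance Definition _ := [isSub of Cp for (@Cp_fun R G p X oX E)].
HB.instance Definition _ := [Choice of Cp by <:].

Lemma Cp_submod_closed : submod_closed (Cp_pred p X E).
Proof.
split=> [|a f g]; first by rewrite inE; split=> //; exact: is_Cp0.
rewrite !inE => -[Cf f0] [Cg g0]; split; first exact: is_Cp_linear.
by move=> x Xx; rewrite !fctE f0// g0// scaler0 addr0.
Qed.

HB.instance Definition _ :=
  GRing.isSubmodClosed.Build _ _ (Cp_pred p X E) Cp_submod_closed.
HB.instance Definition _ := [SubChoice_isSubLmodule of Cp by <:].

Lemma CpP (f g : Cp) : (forall x, X x -> f x = g x) -> f = g.
Proof.
move=> fg; apply: val_inj; apply: funext => x /=.
have [/fg//|Xx] := pselect (X x).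
by case: f g {fg} => f /= + [g /=]; rewrite !inE => -[_ f0] [_ g0]; rewrite f0// g0.
Qed.

Lemma Cp_is_Cp (f : Cp) : is_Cp p X f.
Proof. by case: f => f /=; rewrite inE => -[]. Qed.

Lemma Cp_restrict_subproof (f : G -> E) :
  is_Cp p X f -> patch (fun=> 0) X f \in Cp_pred p X E.
Proof.
move=> Cf; rewrite inE; split; last first.
  by move=> x Xx; rewrite /patch memNset.
by apply: is_Cp_eq Cf => // x Xx; rewrite /patch mem_set.
Qed.

Definition Cp_restrict (f : G -> E) (Cf : is_Cp p X f) : Cp :=
  MkCp oX _ (Cp_restrict_subproof Cf).

Lemma Cp_restrictE f Cf x : X x -> @Cp_restrict f Cf x = f x.
Proof. by move=> Xx; rewrite /= /patch mem_set. Qed.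

(* The topology generated by the seminorms rho_(K, k), K a compact subset of X
   and k in N_p: its open semiballs with arbitrary centers form a subbase. *)
Definition Cp_seminorm (K : set G) (k : nat) (f : Cp) : R :=
  sup [set r | exists x j, [/\ K x, (j <= k)%N & r = `|frechet_deriv f j x|]].

Definition Cp_open_semiball : set (set Cp) :=
  [set U | exists (K : set G) (k : nat) (f : Cp) (e : R),
     [/\ compact K, K `<=` X, le_ord k p, 0 < e &
         U = [set g | Cp_seminorm K k (g - f) < e]]].

HB.instance Definition _ := isSubBaseTopological.Build Cp Cp_open_semiball id.

End CpStructure.

Section Polynomials.
Context {R : realType} {G E : normedModType R}.

Lemma sym_app_norm k (S : Sym k.+1 G E) x : `|sym_app S x| <= `|S| * `|x|.
Proof.
apply: opnorm_le; split=> [|v]; first exact: mulr_ge0.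
have [_ /(_ (consf x v))] := norm_bound_opnorm S.
by rewrite consf_prod mulrA.
Qed.

Lemma sym_app_bilinear k : bilinear_for
  (GRing.Scale.Law.clone _ _ ( *:%R ) _) (GRing.Scale.Law.clone _ _ ( *:%R ) _)
  (@sym_app R G E k).
Proof.
split=> [x a S T|S a x y]; apply: symP => v //=.
rewrite -(dfwith_consf 0 (a *: x + y)) sym_linear !dfwith_consf//.
Qed.

HB.instance Definition _ k := bilinear_isBilinear.Build R _ _ _ _ _
  (@sym_app R G E k) (@sym_app_bilinear k).

Lemma sym_app_continuous k :
  continuous (fun p : Sym k.+1 G E * G => sym_app p.1 p.2).
Proof.
move=> [S x]; rewrite /continuous_at /=; apply/subr_cvg0/norm_cvg0P.
have h1 : (fun p : Sym k.+1 G E * G => p.1) @ (S, x) --> S by exact: cvg_fst.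
have h2 : (fun p : Sym k.+1 G E * G => p.2) @ (S, x) --> x by exact: cvg_snd.
have h : (fun p : Sym k.+1 G E * G => `|p.1 - S| * `|p.2| + `|S| * `|p.2 - x|)
    @ (S, x) --> 0.
  rewrite -[X in _ --> X](_ : 0 * `|x| + `|S| * 0 = 0); last first.
    by rewrite mul0r mulr0 addr0.
  apply: cvgD; first apply: cvgM.
  + by apply/norm_cvg0P/subr_cvg0.
  + exact: cvg_norm.
  + apply: cvgM; first exact: cvg_cst.
    by apply/norm_cvg0P/subr_cvg0.
apply: (squeeze_cvgr _ (cvg_cst 0) h).
apply: nearW => -[T y] /=; rewrite normr_ge0/=.
have -> : sym_app T y - sym_app S x = sym_app (T - S) y + sym_app S (y - x).
  by rewrite linearBl linearBr subrKA.
by rewrite (le_trans (ler_normD _ _))// lerD// sym_app_norm.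
Qed.

Lemma is_diff_sym_app k (A : G -> Sym k.+1 G E) dA (c x : G) :
  is_diff x A dA ->
  is_diff x (fun y => sym_app (A y) (y - c))
    (fun h => sym_app (A x) h + sym_app (dA h) (x - c)).
Proof.
move=> hA.
have hB : is_diff x (fun y : G => y - c) id.
  have := is_diffB (is_diff_id x) (is_diff_cst c x).
  by rewrite subr0.
have hC := is_diff_pair hA hB.
have hD : is_diff (A x, x - c) (fun p : Sym k.+1 G E * G => sym_app p.1 p.2)
    (fun q => sym_app (A x) q.2 + sym_app q.1 (x - c)).
  have cb := @sym_app_continuous k.
  split; first exact: differentiable_bilin.
  by rewrite diff_bilin.
exact: (is_diff_comp hC hD).
Qed.

Inductive is_poly (c : G) : forall j, (G -> Sym j G E) -> Prop :=
| is_poly_cst j (A : Sym j G E) : is_poly c (cst A)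
| is_poly_app j (B : G -> Sym j.+1 G E) :
    is_poly c B -> is_poly c (fun x => sym_app (B x) (x - c))
| is_poly_add j (A B : G -> Sym j G E) :
    is_poly c A -> is_poly c B -> is_poly c (A + B).

Lemma sym_app_swap k (S : Sym k.+2 G E) x y :
  sym_app (sym_app S x) y = sym_app (sym_app S y) x.
Proof.
apply: symP => v /=.
rewrite -(sym_symmetric S _ (tperm ord0 (lift ord0 ord0))); congr (S _).
apply/funext => i; rewrite /=.
case: tpermP => [->|->|/eqP i0 /eqP i1].
- by rewrite consfS !consf0.
- by rewrite consfS !consf0.
- case: (unliftP ord0 i) i0 i1 => [l|] -> // _ i1; rewrite !consfS.
  case: (unliftP ord0 l) i1 => [m|] ->; last by rewrite eqxx.
  by rewrite !consfS.
Qed.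

Lemma is_poly_diff c j (A : G -> Sym j G E) : is_poly c A ->
  exists2 A', is_poly c A' & forall x, is_diff x A (sym_app (A' x)).
Proof.
elim=> {j A} [j A|j B pB [B' pB' dB]|j A B _ [A' pA' dA] _ [B' pB' dB]].
- exists (cst 0); first exact: is_poly_cst.
  move=> x; have -> : sym_app (cst 0 x : Sym j.+1 G E) = 0.
    by apply/funext => y; apply: symP.
  exact: is_diff_cst.
- exists (B + (fun x => sym_app (B' x) (x - c))).
    by apply: is_poly_add => //; exact: is_poly_app.
  move=> x; have -> : sym_app ((B + (fun x => sym_app (B' x) (x - c))) x) =
      (fun h => sym_app (B x) h + sym_app (sym_app (B' x) h) (x - c)).
    by apply/funext => h; rewrite sym_app_swap; apply: symP.
  exact: is_diff_sym_app.
- exists (A' + B'); first exact: is_poly_add.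
  move=> x; have -> : sym_app ((A' + B') x) = sym_app (A' x) + sym_app (B' x).
    by apply/funext => y; apply: symP.
  exact: is_diffD.
Qed.

Lemma sym_pow_is_poly k (S : Sym k G E) (c : G) :
  is_poly c (fun x => sym_const (sym_pow S (x - c))).
Proof.
have H d : forall j, (j + d)%N = k -> exists B : G -> Sym j G E, is_poly c B /\
    exists phi : 'I_k -> option 'I_j,
      forall x v, B x v = S (fun i => oapp v (x - c) (phi i)).
  elim: d => [|d IH] j.
    rewrite addn0 => jk; case: k / jk S => S.
    by exists (cst S); split; [exact: is_poly_cst|exists Some].
  rewrite addnS -addSn => /IH[B [pB [phi phiE]]].
  exists (fun x => sym_app (B x) (x - c)); split; first exact: is_poly_app.
  exists (fun i => obind (unlift ord0) (phi i)) => x v /=; rewrite phiE.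
  by congr (S _); apply/funext => i; case: (phi i).
have [B [pB [phi phiE]]] := H k 0%N (add0n k).
rewrite (_ : (fun _ => _) = B)//; apply/funext => x; apply: symP => v.
rewrite phiE /= /sym_pow; congr (S _); apply/funext => i.
by case: (phi i) => // -[].
Qed.

Lemma sym_pow_is_Cp p (X : set G) k (S : Sym k G E) (c : G) :
  is_Cp p X (fun x => sym_pow S (x - c)).
Proof.
set f := fun x => _.
have pf j : is_poly c (frechet_deriv f j).
  elim: j => [|j /is_poly_diff[A pA dA]]; first exact: sym_pow_is_poly.
  rewrite (_ : frechet_deriv f j.+1 = A)//; apply/funext => x.
  exact: frechet_deriv_eq.
split=> j _.
  move=> x _; have [A _ dA] := is_poly_diff (pf j).
  by rewrite (frechet_deriv_eq (dA x)).
apply: continuous_subspaceT => x; have [A _ dA] := is_poly_diff (pf j).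
exact/differentiable_continuous/(@ex_diff _ _ _ _ _ _ _ (dA x)).
Qed.

End Polynomials.

Section MonomialForms.
Context {R : realType} {n : nat} {E : normedModType R}.
Variables (lam : 'I_n -> nat) (u : E).
Local Notation k := (\sum_(i < n) lam i)%N.

(* The words of length |lam| in which each letter i occurs lam i times. *)
Definition mono_words : {set {ffun 'I_k -> 'I_n}} :=
  [set c : {ffun 'I_k -> 'I_n} | [forall i, #|[pred j | c j == i]| == lam i]]%SET.

Definition mono_fun (v : 'I_k -> 'rV[R]_n) : E :=
  (#|mono_words|%:R^-1 * \sum_(c in mono_words) \prod_(j < k) v j ord0 (c j)) *: u.

Lemma rV_entry_norm (x : 'rV[R]_n) i : `|x ord0 i| <= `|x|.
Proof.
rewrite [leRHS]/Num.norm/= mx_normrE.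
exact: (le_bigmax _ (fun ij : 'I_1 * 'I_n => `|x ij.1 ij.2|) (ord0, i)).
Qed.

Lemma mono_fun_subproof : mono_fun \in symml.
Proof.
rewrite inE; split=> [v i a x y|v s|].
- rewrite /mono_fun scalerA -scalerDl mulrCA -mulrDr; congr ((_ * _) *: _).
  rewrite mulr_sumr -big_split; apply: eq_bigr => c _ /=.
  have P z : \prod_(j < k) dfwith v i z j ord0 (c j) =
      z ord0 (c i) * \prod_(j < k | j != i) v j ord0 (c j).
    rewrite (bigD1 i)//= dfwithin; congr (_ * _).
    by apply: eq_bigr => j ji; rewrite dfwithout// eq_sym.
  by rewrite !P !mxE mulrDl mulrA.
- rewrite /mono_fun; congr ((_ * _) *: _).
  pose r (t : 'S_k) (c : {ffun 'I_k -> 'I_n}) := [ffun j => c (t j)].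
  have rK t : cancel (r t^-1%g) (r t).
    by move=> c; apply/ffunP => j; rewrite !ffunE permK.
  have rw t c : c \in mono_words -> r t c \in mono_words.
    rewrite !inE => /forallP cw; apply/forallP => i.
    rewrite -(eqP (cw i)) -(card_imset _ (@perm_inj _ t)); apply/eqP/eq_card => j.
    apply/imsetP/idP => [[l]|].
      by rewrite !inE ffunE => /eqP <- ->.
    by rewrite inE => cj; exists (t^-1%g j); rewrite ?inE ?ffunE permKV.
  rewrite (reindex_onto (r s) (r s^-1%g)) => [|c _]; last exact: rK.
  apply: eq_big => [c|c _].
    have e : r s^-1%g (r s c) = c by have := rK s^-1%g c; rewrite invgK.
    rewrite e eqxx andbT; apply/idP/idP => [/(rw s^-1%g)|/rw//].
    by rewrite e.
  rewrite [RHS](reindex_inj (@perm_inj _ s)).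
  by apply: eq_bigr => j _; rewrite ffunE.
- exists (`|#|mono_words|%:R^-1| * #|mono_words|%:R * `|u|).
  split=> [|v]; first by rewrite !mulr_ge0.
  rewrite normrZ normrM -!mulrA ler_wpM2l// (mulrC `|u|) mulrA ler_wpM2r//.
  rewrite (le_trans (ler_norm_sum _ _ _))// mulrC -sumr_const mulr_sumr.
  rewrite ler_sum// => c _; rewrite mulr1 normr_prod.
  by apply: ler_prod => j _; rewrite normr_ge0 rV_entry_norm.
Qed.

(* S_(lam, u), the polarization of x |-> x^lam u. *)
Definition mono_form : Sym k 'rV[R]_n E := MkSym _ mono_fun_subproof.

Lemma mono_words_gt0 : (0 < #|mono_words|)%N.
Proof.
pose w := flatten [seq nseq (lam i) i | i <- enum 'I_n].
have sw : size w == k.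
  rewrite size_flatten /shape -map_comp sumnE big_map big_enum/=.
  by apply/eqP/eq_bigr => i _; rewrite size_nseq.
apply/card_gt0P; exists [ffun j => tnth (Tuple sw) j].
rewrite inE; apply/forallP => i; apply/eqP.
transitivity (count_mem i (Tuple sw)).
  rewrite -[in RHS](map_tnth_enum (Tuple sw)) count_map -sum1_card -sum1_count.
  by rewrite big_enum_cond /=; apply: eq_bigl => j; rewrite !inE ffunE.
rewrite /= count_flatten -map_comp sumnE big_map big_enum/=.
rewrite (bigD1 i)//= count_nseq /= eqxx mul1n big1 ?addn0// => j ji.
by rewrite count_nseq /= (negPf ji).
Qed.

Lemma mono_formE x : sym_pow mono_form x = (\prod_(i < n) x ord0 i ^+ lam i) *: u.
Proof.
rewrite /sym_pow /= /mono_fun; congr (_ *: u).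
rewrite (eq_bigr (fun=> \prod_(i < n) x ord0 i ^+ lam i)).
  rewrite sumr_const -[X in _ * X]mulr_natl mulrA mulVf ?mul1r// pnatr_eq0 -lt0n.
  exact: mono_words_gt0.
move=> c; rewrite inE => /forallP cw.
rewrite (partition_big c predT)//=; apply: eq_bigr => i _.
rewrite -(eqP (cw i)) (eq_bigr (fun=> x ord0 i)) => [|j /eqP->//].
by rewrite prodr_const; congr (_ ^+ _); apply: eq_card => j; rewrite !inE.
Qed.

End MonomialForms.

Section SupportMap.
Context {R : realType} {G H : normedModType R} {p q : option nat}.
Context {X : set G} {oX : open X} {Y : set H} {oY : open Y}.
Context {E F : normedModType R}.
Variable T : Cp p oX E -> Cp q oY F.

Definition separating := forall f g : Cp p oX E,
  (forall x, X x -> f x = 0 \/ g x = 0) ->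
  forall y, Y y -> T f y = 0 \/ T g y = 0.

Definition nowhere_trivial := forall y, Y y -> exists f : Cp p oX E, T f y <> 0.

(* i : X -> R_oo^(C^p(X)); [Some] is the inclusion of R in R_oo and the product
   carries the topology of pointwise convergence. *)
Definition embed (x : G) :
    {ptws Cp p oX R^o -> one_point_compactification R} :=
  fun psi => Some (psi x).

Definition compactification := closure (embed @` X).

Definition relatively_open (W : set {ptws Cp p oX R^o -> one_point_compactification R}) :=
  exists2 O, open O & W = compactification `&` O.

(* The closure in compactification, which is closed in the ambient product. *)
Definition relative_closure W := compactification `&` closure W.

Definition closed_support (f : Cp p oX E) :=
  relative_closure (embed @` [set x | X x /\ f x <> 0]).

Definition support_family (y : H) :=
  [set W | relatively_open W /\
     exists2 f : Cp p oX E, T f y <> 0 & closed_support f `<=` W].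

(* h(y) is the unique point of the intersection below, points of X being
   identified with their images under [embed]; nothing is said outside Y. *)
Definition is_support_map (h : H -> G) := forall y, Y y ->
  X (h y) /\
  \bigcap_(W in support_family y) relative_closure W = [set embed (h y)].

Definition Phi (h : H -> G) (k : nat) (y : H) (S : Sym k G E) : F :=
  k`!%:R^-1 *: T (Cp_restrict oX (sym_pow_is_Cp p X S (h y))) y.

End SupportMap.

(* Main.v *)
Require Import Defs.
From HB Require Import structures.
From mathcomp Require Import all_boot all_order all_algebra all_fingroup.
From mathcomp Require Import finmap ring lra.
From mathcomp Require Import all_classical all_reals all_analysis.
Import Order.TTheory GRing.Theory Num.Theory.
Import numFieldNormedType.Exports.
Local Open Scope classical_set_scope.
Local Open Scope ring_scope.

(** Write c = h(y), z = x_i, s = h_i(y), m = m_0.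

    Locality.  If f vanishes near c, then Tf(y) = 0: otherwise a plateau
    function at c, taken as a coordinate of the compactification, separates c
    from the closed support of f and yields a member of the family O_y whose
    closure misses c ([vanish_near_support]).  Together with the continuity of
    T this gives T((x - c)^lam u)(y) = 0 whenever |lam| > p: the function
    d^|lam| b((x - c) / d), with b(x) = x^lam u times a plateau function at 0,
    agrees with (x - c)^lam u near c, and its derivatives of order j <= p are
    O(d^(|lam| - j)), so that it tends to 0 in C^p(X, E)
    ([monomial_eq0_finite_order]).  Hence the hypothesis on Phi gives
    T((x - c)^lam u)(y) = 0 for all y in V and all lam with lam_i > m, whatever
    |lam| is.

    Linear recurrence.  Fix w(x) = prod_(j <> i) (x_j - h_j(y0))^(mu_j) and
    consider the linear functional Q |-> T(Q(z) w u)(y) on polynomials in one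
    variable.  Expanding in powers of x - c, the previous vanishing shows that
    for y in V it kills every multiple of (X - s)^(m+1) ([annihilated_poly]),
    while for y = y0 its value at (X - s)^m is T((x - h(y0))^mu u)(y0), which is
    not 0.  Composing with a bounded functional phi on F that does not vanish on
    that vector ([hahn_banach_functional]) gives scalar functionals l_y.

    Cramer's rule.  The moments t_k(y) = l_y(X^k) are C^q functions of y, as
    images under phi of values of T on fixed functions.  They satisfy the
    recurrence with characteristic polynomial (X - s)^(m+1), whose coefficient
    of X^m is -(m+1) s; the Hankel determinant det (t_(a+b)(y))_(a, b <= m) is
    not 0 at y0 ([hankel_unit]), hence near y0, and solving the linear system
    for that coefficient writes (m+1) h_i(y) as a quotient of polynomials in the
    t_k(y) with nonvanishing denominator ([hankel_root]).  So h_i is C^q near y0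
    once C^q functions are known to be stable under products and quotients
    ([is_Cp_scale], [is_Cp_quotient]).

    For these two stability results the Leibniz formula is organised by
    contractions.  A form of degree k+1 is determined by its contractions
    against one vector, and the contraction of D^(k+1) f(x) is the derivative of
    D^k f at x.  So the terms of the Leibniz formula are defined by recursion on
    k, the contraction of a product being given by the product rule. *)

Set Implicit Arguments.
Unset Strict Implicit.
Unset Printing Implicit Defensive.

(* The permutation library also exports a constant Sym. *)
Local Notation Sym := Defs.Sym.

(** * Bounded linear and bilinear maps; jets *)
Section BoundedMaps.
Context {R : realType}.

Lemma bounded_linear_cont (V W : normedModType R) (f : {linear V -> W}) M :
  (forall u, `|f u| <= M * `|u|) -> continuous f.
Proof.
move=> fM; apply: bounded_linear_continuous; apply/linear_boundedP.
have : \forall r \near +oo, M <= r by exact: nbhs_pinfty_ge (num_real _).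
apply: filterS => r Mr x; by rewrite (le_trans (fM x))// ler_wpM2r.
Qed.

Lemma is_diff_linear (U V W : normedModType R) (f : V -> W) M (g dg : U -> V) x :
  linear f -> (forall u, `|f u| <= M * `|u|) -> is_diff x g dg ->
  is_diff x (f \o g) (f \o dg).
Proof.
move=> fl fM dgx; pose flM := GRing.isLinear.Build _ _ _ _ _ fl.
pose fL : {linear _ -> _} := HB.pack f flM.
have fc : continuous fL by exact: (@bounded_linear_cont _ _ fL M).
suff : is_diff (g x) fL fL by exact: is_diff_comp.
by apply: DiffDef; [exact: linear_differentiable|rewrite diff_lin].
Qed.

Lemma bounded_bilinear_cont (U V W : normedModType R) (f : U -> V -> W) M :
  (forall u, linear (f u)) -> (forall v, linear (f^~ v)) ->
  (forall u v, `|f u v| <= M * `|u| * `|v|) ->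
  continuous (fun p : U * V => f p.1 p.2).
Proof.
move=> fr fl fM [u v]; rewrite /continuous_at /=; apply/subr_cvg0/norm_cvg0P.
have h1 : (fun p : U * V => p.1) @ (u, v) --> u by exact: cvg_fst.
have h2 : (fun p : U * V => p.2) @ (u, v) --> v by exact: cvg_snd.
have h : (fun p : U * V => M * `|p.1 - u| * `|p.2| + M * `|u| * `|p.2 - v|)
    @ (u, v) --> 0.
  rewrite -[X in _ --> X](_ : M * 0 * `|v| + M * `|u| * 0 = 0); last first.
    by rewrite !mulr0 mul0r addr0.
  apply: cvgD; apply: cvgM.
  + by apply: cvgM; [exact: cvg_cst|apply/norm_cvg0P/subr_cvg0].
  + exact: cvg_norm.
  + exact: cvg_cst.
  + by apply/norm_cvg0P/subr_cvg0.
apply: (squeeze_cvgr _ (cvg_cst 0) h).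
apply: nearW => -[a b] /=; rewrite normr_ge0/=.
have -> : f a b - f u v = f (a - u) b + f u (b - v).
  have -> : a - u = (-1) *: u + a by rewrite scaleN1r addrC.
  have -> : b - v = (-1) *: v + b by rewrite scaleN1r addrC.
  by rewrite fl fr !scaleN1r (addrC (- f u v)) addrA (addrC (- f u b)) subrK.
by rewrite (le_trans (ler_normD _ _))// lerD.
Qed.

Lemma is_diff_bilinear (G U V W : normedModType R) (f : U -> V -> W) M
    (a da : G -> U) (b db : G -> V) x :
  (forall u, linear (f u)) -> (forall v, linear (f^~ v)) ->
  (forall u v, `|f u v| <= M * `|u| * `|v|) ->
  is_diff x a da -> is_diff x b db ->
  is_diff x (fun y => f (a y) (b y))
    (fun h => f (da h) (b x) + f (a x) (db h)).
Proof.
move=> fr fl fM dax dbx.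
have fbil : bilinear_for (GRing.Scale.Law.clone _ _ ( *:%R ) _)
    (GRing.Scale.Law.clone _ _ ( *:%R ) _) f.
  by split=> [v c u u'|u c v v'] /=; [exact: fl|exact: fr].
pose fB := bilinear_isBilinear.Build R U V W _ _ f fbil.
pose fL : {bilinear U -> V -> W} := HB.pack f fB.
have fc : continuous (fun p : U * V => fL p.1 p.2).
  exact: (@bounded_bilinear_cont _ _ _ f M).
have hD : is_diff (a x, b x) (fun p : U * V => fL p.1 p.2)
    (fun q => f (a x) q.2 + f q.1 (b x)).
  by split; [exact: differentiable_bilin|rewrite diff_bilin].
apply: is_diff_eq; first exact: (is_diff_comp (is_diff_pair dax dbx) hD).
by apply/funext => h /=; rewrite addrC.
Qed.

Lemma is_diff_continuous (V W : normedModType R) (f df : V -> W) x :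
  is_diff x f df -> {for x, continuous f}.
Proof. by move=> dfx; exact/differentiable_continuous/ex_diff. Qed.

Lemma is_diff_sum (V W : normedModType R) (I : finType) (P : pred I)
    (f df : I -> V -> W) x :
  (forall i, P i -> is_diff x (f i) (df i)) ->
  is_diff x (fun y => \sum_(i | P i) f i y) (fun h => \sum_(i | P i) df i h).
Proof.
move=> fdf.
rewrite (_ : (fun y => _) = \sum_(i | P i) f i); last first.
  by apply/funext => y; rewrite fct_sumE.
rewrite (_ : (fun h => _) = \sum_(i | P i) df i); last first.
  by apply/funext => y; rewrite fct_sumE.
elim/big_ind2: _ => //; first exact: is_diff_cst.
by move=> a a' b b' ? ?; exact: is_diffD.
Qed.

End BoundedMaps.

Section Jets.
Context {R : realType} {G E : normedModType R}.
Implicit Types (p : option nat) (X : set G) (f : G -> E).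

(** A form is determined by its contractions, so a sequence of maps in which
    each differentiates to the next can only be the sequence of derivatives of
    f.  Stability results are obtained by writing down such a sequence. *)
Lemma is_Cp_jet p X f (D : forall k, G -> Sym k G E) : open X ->
  (forall x, X x -> D 0%N x = sym_const (f x)) ->
  (forall k, le_ord k.+1 p -> forall x, X x ->
     is_diff x (D k) (sym_app (D k.+1 x))) ->
  (forall k, le_ord k p -> forall x, X x -> {for x, continuous (D k)}) ->
  is_Cp p X f /\
  (forall k, le_ord k p -> forall x, X x -> frechet_deriv f k x = D k x).
Proof.
move=> oX D0 dD cD.
have nX x : X x -> \forall y \near x, X y by move=> Xx; exact: open_nbhs_nbhs.
have fD k : le_ord k p -> forall x, X x -> frechet_deriv f k x = D k x.
  elim: k => [|k IH] kp x Xx; first by rewrite D0.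
  apply: frechet_deriv_eq; apply: (near_is_diff _ (dD k kp x Xx)).
  by apply: filterS (nX x Xx) => y Xy; rewrite IH//; exact: le_ordW.
split=> //; split=> k kp.
  move=> x Xx; rewrite fD//; apply: (near_is_diff _ (dD k kp x Xx)).
  by apply: filterS (nX x Xx) => y Xy; rewrite fD//; exact: le_ordW.
apply: (@subspace_eq_continuous _ X _ (D k)).
  by move=> x /set_mem Xx; exact/esym/fD.
by apply/continuous_in_subspaceT => x /set_mem Xx; exact: cD.
Qed.

Lemma is_Cp_diff p X f k x : is_Cp p X f -> le_ord k.+1 p -> X x ->
  is_diff x (frechet_deriv f k) (sym_app (frechet_deriv f k.+1 x)).
Proof. by move=> [df _] kp; exact: df. Qed.

Lemma is_Cp_cont p X f k x : open X -> is_Cp p X f -> le_ord k p -> X x ->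
  {for x, continuous (frechet_deriv f k)}.
Proof.
move=> oX [_ cf] kp Xx.
by have := cf _ kp; rewrite continuous_open_subspace// => /(_ x (mem_set Xx)).
Qed.

Lemma is_Cp_local p X f :
  (forall x, X x -> exists W, [/\ open W, W x & is_Cp p W f]) ->
  open X -> is_Cp p X f.
Proof.
move=> Xloc oX; split=> k kp.
  by move=> x /Xloc[W [oW Wx /is_Cp_diff]]; exact.
apply/continuous_in_subspaceT => x /set_mem /Xloc[W [oW Wx Cf]].
exact: is_Cp_cont Cf _ _.
Qed.

Lemma is_Cp_sub p X W f : open X -> open W -> W `<=` X ->
  is_Cp p X f -> is_Cp p W f.
Proof.
move=> oX oW WX Cf; split=> k kp.
  by move=> x Wx; apply: (is_Cp_diff Cf) => //; exact: WX.
apply/continuous_in_subspaceT => x /set_mem Wx.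
by apply: is_Cp_cont Cf _ _ => //; exact: WX.
Qed.

Lemma is_Cp_le p r X f : (forall k, le_ord k r -> le_ord k p) ->
  is_Cp p X f -> is_Cp r X f.
Proof. by move=> rp [df cf]; split=> k /rp; [exact: df|exact: cf]. Qed.

Lemma sym_const_norm (u : E) : `|sym_const u : Sym 0 G E| = `|u|.
Proof.
apply/eqP; rewrite eq_le; apply/andP; split.
  by apply: opnorm_le; split=> // v; rewrite big_ord0 mulr1.
have [_ /(_ (fun=> 0))] := norm_bound_opnorm (sym_const u : Sym 0 G E).
by rewrite big_ord0 mulr1.
Qed.

Lemma sym_const_linear : linear (@sym_const R G E).
Proof. by move=> a u v; apply: symP. Qed.

Lemma sym0E (S : Sym 0 G E) : S = sym_const (S (fun=> 0)).
Proof. by apply: symP => v /=; congr (S _); apply/funext => -[]. Qed.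

End Jets.

(** * Symmetric forms from symmetric families of contractions *)
Section Contraction.
Context {R : realType} {G E : normedModType R}.

(** The total version of [sym_app], zero on constants: identities on
    contractions then hold in all degrees without distinguishing degree 0. *)
Definition contract k : Sym k G E -> G -> Sym k.-1 G E :=
  match k with 0 => fun _ _ => 0 | k'.+1 => @sym_app R G E k' end.

Lemma sym_app_linearr k (S : Sym k.+1 G E) a x y :
  sym_app S (a *: x + y) = a *: sym_app S x + sym_app S y.
Proof. by rewrite linearPr. Qed.

Lemma sym_app_linearl k x a (S T : Sym k.+1 G E) :
  sym_app (a *: S + T) x = a *: sym_app S x + sym_app T x.
Proof. by rewrite linearPl. Qed.

Lemma contract_linearr k (S : Sym k G E) a x y :
  contract S (a *: x + y) = a *: contract S x + contract S y.
Proof.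
by case: k S => [|k] S; [rewrite /= scaler0 addr0|exact: sym_app_linearr].
Qed.

Lemma contract_linearl k x a (S T : Sym k G E) :
  contract (a *: S + T) x = a *: contract S x + contract T x.
Proof.
by case: k S T => [|k] S T; [rewrite /= scaler0 addr0|exact: sym_app_linearl].
Qed.

Lemma contract_norm k (S : Sym k G E) x : `|contract S x| <= `|S| * `|x|.
Proof.
case: k S => [|k] S; last exact: sym_app_norm.
by rewrite normr0 mulr_ge0.
Qed.

Lemma contract_swap k (S : Sym k G E) x y : contract (contract S x) y = contract (contract S y) x.
Proof. by case: k S => [|[|k]] S //; exact: sym_app_swap. Qed.

Lemma consf_eta k (v : 'I_k.+1 -> G) : consf (v ord0) (v \o lift ord0) = v.
Proof.
apply/funext => j; case: (unliftP ord0 j) => [l|] ->; first by rewrite consfS.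
by rewrite consf0.
Qed.

Lemma sym_norm_le k (S : Sym k.+1 G E) M : 0 <= M ->
  (forall x, `|sym_app S x| <= M * `|x|) -> `|S| <= M.
Proof.
move=> M0 SM; apply: opnorm_le; split=> // v.
rewrite -(consf_eta v) consf_prod mulrA.
have [_ /(_ (v \o lift ord0))] := norm_bound_opnorm (sym_app S (v ord0)).
move=> /le_trans; apply; rewrite ler_wpM2r ?prodr_ge0//; exact: SM.
Qed.

(** Only the invariance under permutations needs an argument.  Transpositions
    generate; one that fixes the first argument is absorbed by the symmetric
    form A x.  One that exchanges the first argument with the j-th is, up to a
    transposition of the tail that moves the j-th argument to the front, the
    exchange of the first two arguments, which is the last hypothesis. *)
Lemma sym_uncurry k (A : G -> Sym k G E) M :
  (forall a x y, A (a *: x + y) = a *: A x + A y) -> (forall x, `|A x| <= M * `|x|) ->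
  (forall x y, contract (A x) y = contract (A y) x) ->
  exists S : Sym k.+1 G E, sym_app S = A.
Proof.
move=> Al AM Asw; pose f v := A (v ord0) (v \o lift ord0).
have fc x v : f (consf x v) = A x v.
  rewrite /f consf0; congr (A x _); apply/funext => i /=; exact: consfS.
suff fP : f \in symml.
  exists (MkSym f fP); apply/funext => x; apply: symP => v; exact: fc.
rewrite inE; split.
- move=> v i a x y; rewrite -(consf_eta v).
  case: (unliftP ord0 i) => [j|] ->; last by rewrite !dfwith_consf !fc Al.
  by rewrite -!consf_dfwith !fc sym_linear.
- have ft0 : forall j v, f (v \o tperm ord0 (lift ord0 j)) = f v.
    case: k A Al AM Asw @f fc => [A ? ? ? ? ? []//|k A Al AM Asw f fc j v].
    rewrite -[in RHS](consf_eta v) fc -(sym_symmetric _ _ (tperm ord0 j)).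
    set u := (v \o lift ord0) \o tperm ord0 j.
    rewrite -(consf_eta u).
    have /= -> := congr1 (fun S : Sym k G E => S (u \o lift ord0))
      (Asw (v ord0) (u ord0)).
    rewrite -(sym_symmetric (A _) (consf _ _) (tperm ord0 j)) /f /u /= !tpermL.
    congr (A _ _); apply/funext => l /=.
    case: (tpermP ord0 j l) => [->|->|/eqP l0 /eqP lj].
    + case: (unliftP ord0 j) => [m|] ->; last by rewrite consf0 tpermR.
      by rewrite consfS /= tpermR tpermD// ?(inj_eq lift_inj) ?neq_lift// eq_sym
        neq_lift.
    + by rewrite consf0 tpermR.
    + case: (unliftP ord0 l) l0 lj => [m|] -> l0 lj; last by rewrite eqxx in l0.
      rewrite consfS /= !tpermD ?neq_lift// ?(inj_eq lift_inj) 1?eq_sym//.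
  have ftp a b : forall v, f (v \o tperm a b) = f v.
    wlog : a b / (a <= b)%N.
      move=> wl; have [/wl//|/ltnW ba] := leqP a b.
      by move=> v; rewrite tpermC; exact: wl.
    case: (unliftP ord0 b) => [j|] -> ab v; last first.
      have -> : a = ord0 by apply/val_inj/eqP; rewrite -leqn0.
      by congr f; apply/funext => i; rewrite /= tperm1 perm1.
    case: (unliftP ord0 a) {ab} => [i|] ->.
      rewrite -[in RHS](consf_eta v) fc -(sym_symmetric _ _ (tperm i j)) -fc.
      congr f; apply/funext => l; case: (unliftP ord0 l) => [m|] -> /=.
        by rewrite consfS /= inj_tperm//; exact: lift_inj.
      by rewrite consf0 tpermD// neq_lift.
    exact: ft0.
  move=> v s; case: (prod_tpermP s) => ts -> _ {s}.
  elim: ts v => [|[a b] ts IH] v.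
    by rewrite big_nil; congr f; apply/funext => i; rewrite /= perm1.
  rewrite big_cons /= -[RHS](IH) -[RHS](ftp a b); congr f; apply/funext => i.
  by rewrite /= permM.
- exists `|M|; split=> // v; rewrite big_ord_recl mulrA /f.
  have [_ /(_ (v \o lift ord0)) /le_trans] := norm_bound_opnorm (A (v ord0)).
  apply; rewrite ler_wpM2r ?prodr_ge0//.
  by rewrite (le_trans (AM _))// ler_wpM2r// ler_norm.
Qed.

Definition uncurry k (A : G -> Sym k G E) : Sym k.+1 G E :=
  xget 0 [set S | sym_app S = A].

Lemma uncurryE k (A : G -> Sym k G E) M :
  (forall a x y, A (a *: x + y) = a *: A x + A y) -> (forall x, `|A x| <= M * `|x|) ->
  (forall x y, contract (A x) y = contract (A y) x) -> sym_app (uncurry A) = A.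
Proof.
move=> Al AM Asw; have [S SA] := sym_uncurry Al AM Asw.
by rewrite /uncurry; case: xgetP => [T _ //|/(_ S)].
Qed.

End Contraction.

(** * Shuffle products and the Leibniz formula *)
Section SymProduct.
Context {R : realType} {G E : normedModType R}.

Lemma linear_map0 (V W : normedModType R) (f : V -> W) : linear f -> f 0 = 0.
Proof. by move=> fl; have := fl (-1) 0 0; rewrite !scaler0 addr0 scaleN1r addNr. Qed.

Lemma linear_map_sum (V W : normedModType R) (f : V -> W) (I : finType) (F : I -> V) :
  linear f -> f (\sum_i F i) = \sum_i f (F i).
Proof.
move=> fl; elim/big_ind2: _ => //; first exact: linear_map0.
by move=> a b c d <- <-; have := fl 1 b d; rewrite !scale1r.
Qed.

Lemma sym_app_suml (V : normedModType R) k (I : finType) (F : I -> Sym k.+1 G V) x :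
  sym_app (\sum_i F i) x = \sum_i sym_app (F i) x.
Proof.
apply: (@linear_map_sum _ _ (fun S : Sym k.+1 G V => sym_app S x)) => a S T.
exact: sym_app_linearl.
Qed.

Lemma sym_appDl (V : normedModType R) k (S T : Sym k.+1 G V) x :
  sym_app (S + T) x = sym_app S x + sym_app T x.
Proof. by have := sym_app_linearl x 1 S T; rewrite !scale1r. Qed.

(** The shuffle product of S and T, contracted by the product rule.  Its degree
    k is independent of i and j, which avoids transports along i + j = k; it
    vanishes when k < i + j, because contraction then reaches the value at 0 of
    a form of positive degree. *)
Fixpoint shuffle k : forall i j, Sym i G R^o -> Sym j G E -> Sym k G E :=
  match k with
  | 0 => fun i j S T => sym_const ((S (fun=> 0) : R) *: T (fun=> 0))
  | k'.+1 => fun i j S T =>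
      uncurry (fun x => shuffle k' (contract S x) T + shuffle k' S (contract T x))
  end.

Lemma sym_val0_norm (V : normedModType R) i (S : Sym i G V) : `|S (fun=> 0)| <= `|S|.
Proof.
have [S0 /(_ (fun=> 0))/le_trans] := norm_bound_opnorm S; apply.
case: i S S0 => [|i] S S0; first by rewrite big_ord0 mulr1.
by rewrite big_ord_recl normr0 mul0r mulr0.
Qed.

(** Simultaneous induction: the contraction rule in degree k+1 requires
    linearity and bounds in degree k, and it is what yields them in degree
    k+1. *)
Lemma shuffle_spec k :
  [/\ forall i j (S : Sym i G R^o) a (T U : Sym j G E),
        shuffle k S (a *: T + U) = a *: shuffle k S T + shuffle k S U,
      forall i j a (S U : Sym i G R^o) (T : Sym j G E),
        shuffle k (a *: S + U) T = a *: shuffle k S T + shuffle k U T,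
      forall i j S T, `|@shuffle k i j S T| <= 2 ^+ k * `|S| * `|T| &
      forall i j (S : Sym i G R^o) (T : Sym j G E) x, sym_app (shuffle k.+1 S T) x =
        shuffle k (contract S x) T + shuffle k S (contract T x)].
Proof.
elim: k => [|k [lr ll bd ct]].
  have lr i j (S : Sym i G R^o) a (T U : Sym j G E) :
      shuffle 0 S (a *: T + U) = a *: shuffle 0 S T + shuffle 0 S U.
    apply: symP => v; rewrite sym_addE sym_scaleE /=.
    rewrite !fctE.
    by rewrite scalerDr !scalerA mulrC.
  have ll i j a (S U : Sym i G R^o) (T : Sym j G E) :
      shuffle 0 (a *: S + U) T = a *: shuffle 0 S T + shuffle 0 U T.
    apply: symP => v; rewrite sym_addE sym_scaleE /=.
    rewrite !fctE.
    by rewrite scalerDl scalerA.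
  have bd i j (S : Sym i G R^o) (T : Sym j G E) : `|shuffle 0 S T| <= 2 ^+ 0 * `|S| * `|T|.
    by rewrite /= sym_const_norm expr0 mul1r normrZ ler_pM// sym_val0_norm.
  split=> // i j S T x.
  rewrite -[shuffle 1 S T]/(uncurry (fun x =>
    shuffle 0 (contract S x) T + shuffle 0 S (contract T x))).
  rewrite (@uncurryE _ _ _ _ _ (`|S| * `|T| + `|S| * `|T|)) //.
  - move=> a y z; rewrite !contract_linearr lr ll scalerDr addrACA//.
  - move=> y; rewrite (le_trans (ler_normD _ _))// mulrDl lerD//.
      apply: le_trans (bd _ _ _ _) _.
      by rewrite expr0 mul1r mulrAC ler_wpM2r// contract_norm.
    apply: le_trans (bd _ _ _ _) _.
    by rewrite expr0 mul1r -mulrA ler_wpM2l// contract_norm.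
have lr1 i j (S : Sym i G R^o) a (T U : Sym j G E) :
      shuffle k.+1 S (a *: T + U) = a *: shuffle k.+1 S T + shuffle k.+1 S U.
  apply: sym_app_inj; apply/funext => x.
  by rewrite sym_app_linearl !ct contract_linearl !lr scalerDr addrACA.
have ll1 i j a (S U : Sym i G R^o) (T : Sym j G E) :
      shuffle k.+1 (a *: S + U) T = a *: shuffle k.+1 S T + shuffle k.+1 U T.
  apply: sym_app_inj; apply/funext => x.
  by rewrite sym_app_linearl !ct contract_linearl !ll scalerDr addrACA.
have bd1 i j (S : Sym i G R^o) (T : Sym j G E) :
    `|shuffle k.+1 S T| <= 2 ^+ k.+1 * `|S| * `|T|.
  apply: sym_norm_le => [|x]; first by rewrite !mulr_ge0// exprn_ge0.
  rewrite ct (le_trans (ler_normD _ _))// exprS -!mulrA mulr_natl mulr2n.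
  apply: lerD; apply: le_trans (bd _ _ _ _) _; rewrite -!mulrA ler_wpM2l ?exprn_ge0//.
    by rewrite (mulrC `|T|) mulrA ler_wpM2r// contract_norm.
  by rewrite ler_wpM2l// contract_norm.
split=> // i j S T x.
rewrite -[shuffle k.+2 S T]/(uncurry (fun x =>
  shuffle k.+1 (contract S x) T + shuffle k.+1 S (contract T x))).
rewrite (@uncurryE _ _ _ _ _ (2 ^+ k.+2 * `|S| * `|T|)) //.
- by move=> a y z; rewrite !contract_linearr lr1 ll1 scalerDr addrACA.
- move=> y; rewrite (le_trans (ler_normD _ _))// exprS -!mulrA mulr_natl mulr2n.
  apply: lerD; apply: le_trans (bd1 _ _ _ _) _; rewrite -!mulrA ler_wpM2l ?exprn_ge0//.
    by rewrite (mulrC `|T|) mulrA ler_wpM2r// contract_norm.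
  by rewrite ler_wpM2l// contract_norm.
- move=> y z; rewrite -![contract (_ + _) _]/(sym_app (_ + _) _) !sym_appDl !ct.
  by rewrite (contract_swap S y z) (contract_swap T y z) addrACA.
Qed.

Lemma shuffle_linearr k i j (S : Sym i G R^o) a (T U : Sym j G E) :
  shuffle k S (a *: T + U) = a *: shuffle k S T + shuffle k S U.
Proof. by have [+ _ _ _] := shuffle_spec k; exact. Qed.

Lemma shuffle_linearl k i j a (S U : Sym i G R^o) (T : Sym j G E) :
  shuffle k (a *: S + U) T = a *: shuffle k S T + shuffle k U T.
Proof. by have [_ + _ _] := shuffle_spec k; exact. Qed.

Lemma shufflex0 k i j (S : Sym i G R^o) : shuffle k S (0 : Sym j G E) = 0.
Proof. exact: (@linear_map0 _ _ (@shuffle k i j S)) (@shuffle_linearr k i j S). Qed.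

Lemma shuffle0x k i j (T : Sym j G E) : shuffle k (0 : Sym i G R^o) T = 0.
Proof.
apply: (@linear_map0 _ _ (fun S => @shuffle k i j S T)) => a S U.
exact: shuffle_linearl.
Qed.

Lemma shuffle_norm k i j (S : Sym i G R^o) (T : Sym j G E) :
  `|shuffle k S T| <= 2 ^+ k * `|S| * `|T|.
Proof. by have [_ _ +] := shuffle_spec k; exact. Qed.

Lemma shuffle_contract k i j (S : Sym i G R^o) (T : Sym j G E) x :
  sym_app (shuffle k.+1 S T) x = shuffle k (contract S x) T + shuffle k S (contract T x).
Proof. by have [_ _ _] := shuffle_spec k; exact. Qed.

Lemma sym_at0 (V : normedModType R) i (S : Sym i.+1 G V) : S (fun=> 0) = 0.
Proof.
have := linear_map0 (f := sym_app S) (sym_app_linearr S).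
move=> /(congr1 (fun U : Sym i G V => U (fun=> 0))).
rewrite /= => S0; rewrite -[RHS]S0; congr (S _).
by apply/funext => l; rewrite /consf; case: unlift.
Qed.

Lemma shuffle_eq0 k i j (S : Sym i G R^o) (T : Sym j G E) :
  (k < i + j)%N -> shuffle k S T = 0.
Proof.
elim: k i j S T => [|k IH] i j S T kij.
  apply: symP => v /=.
  case: i S kij => [|i] S; last by rewrite sym_at0 scale0r.
  by case: j T => [|j] T // _; rewrite sym_at0 scaler0.
apply: sym_app_inj; apply/funext => x.
rewrite shuffle_contract [RHS]linear0l.
have -> : shuffle k (contract S x) T = 0.
  case: i S kij => [|i] S kij; last exact: IH.
  exact: shuffle0x.
case: j T kij => [|j] T kij; first by rewrite add0r; exact: shufflex0.
by rewrite add0r; apply: IH; rewrite -ltnS -addnS.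
Qed.

Lemma shuffle0 k (S : Sym 0 G R^o) (T : Sym k G E) :
  shuffle k S T = (S (fun=> 0) : R) *: T.
Proof.
elim: k T => [|k IH] T; first by rewrite [in RHS](sym0E T); apply: symP.
apply: sym_app_inj; apply/funext => x.
rewrite shuffle_contract IH /= shuffle0x add0r.
by rewrite linearZl.
Qed.

(** D^k (f g) at a point, in terms of the derivatives of f and g there; the
    binomial coefficients are hidden in the shuffle products, and the terms with
    i + j > k are zero. *)
Definition leibniz k (f : forall i, Sym i G R^o) (g : forall j, Sym j G E) : Sym k G E :=
  \sum_(i < k.+1) \sum_(j < k.+1) shuffle k (f i) (g j).

Definition family_contract (V : normedModType R) (f : forall i, Sym i G V) (x : G) i : Sym i G V :=
  sym_app (f i.+1) x.

Lemma leibniz_contract k f g x :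
  sym_app (leibniz k.+1 f g) x = leibniz k (family_contract f x) g + leibniz k f (family_contract g x).
Proof.
rewrite sym_app_suml.
under eq_bigr do rewrite sym_app_suml.
under eq_bigr do under eq_bigr do rewrite shuffle_contract.
under eq_bigr do rewrite big_split /=.
rewrite big_split /=; congr (_ + _).
  rewrite big_ord_recl big1 ?add0r => [|j _]; last first.
    exact: shuffle0x.
  apply: eq_bigr => i _; rewrite big_ord_recr /= shuffle_eq0 ?addr0//.
  by rewrite addnC leq_addr.
rewrite big_ord_recr /= [X in _ + X]big1 ?addr0 => [|j _]; last first.
  apply: shuffle_eq0; exact: leq_addr.
apply: eq_bigr => i _; rewrite big_ord_recl /=.
by rewrite shufflex0 add0r.
Qed.

Lemma eq_leibniz k f f' g g' : (forall i, (i <= k)%N -> f i = f' i) ->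
  (forall i, (i <= k)%N -> g i = g' i) -> leibniz k f g = leibniz k f' g'.
Proof.
move=> ff gg; apply: eq_bigr => i _; apply: eq_bigr => j _.
by rewrite ff 1?gg// -ltnS.
Qed.

Definition truncate (V : normedModType R) k (g : forall j, Sym j G V) j : Sym j G V :=
  if (j < k)%N then g j else 0.

(** The derivative of order k of g enters only through f g^(k): this is what
    can be solved for g^(k) when dividing by f. *)
Lemma leibniz_top k f g :
  leibniz k f g = (f 0%N (fun=> 0) : R) *: g k + leibniz k f (truncate k g).
Proof.
rewrite -shuffle0 /leibniz [X in _ = X + _](_ : _ = \sum_(i < k.+1) shuffle k (f i) (g k)).
  rewrite -big_split /=; apply: eq_bigr => i _.
  rewrite big_ord_recr [in RHS]big_ord_recr /= {2}/truncate ltnn.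
  rewrite shufflex0 addr0 addrC; congr (_ + _).
  by apply: eq_bigr => j _; rewrite /truncate ltn_ord.
rewrite big_ord_recl big1 ?addr0// => i _; apply: shuffle_eq0.
by rewrite /= addSn ltnS leq_addl.
Qed.

Lemma is_diff_leibniz k (f df : forall i, G -> Sym i G R^o)
    (g dg : forall i, G -> Sym i G E) x :
  (forall i, (i <= k)%N -> is_diff x (f i) (df i)) ->
  (forall i, (i <= k)%N -> is_diff x (g i) (dg i)) ->
  is_diff x (fun y => leibniz k (f^~ y) (g^~ y))
    (fun h => leibniz k (df^~ h) (g^~ x) + leibniz k (f^~ x) (dg^~ h)).
Proof.
move=> dfx dgx; rewrite /leibniz.
rewrite (_ : (fun h => _ + _) = fun h => \sum_(i < k.+1) \sum_(j < k.+1)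
    (shuffle k (df i h) (g j x) + shuffle k (f i x) (dg j h))); last first.
  apply/funext => h; rewrite -big_split; apply: eq_bigr => i _.
  by rewrite -big_split.
apply: is_diff_sum => i _; apply: is_diff_sum => j _.
apply: (is_diff_bilinear (f := @shuffle k i j) (M := 2 ^+ k)).
- exact: shuffle_linearr.
- by move=> v a u u'; exact: shuffle_linearl.
- exact: shuffle_norm.
- by apply: dfx; rewrite -ltnS.
- by apply: dgx; rewrite -ltnS.
Qed.

Lemma leibniz_continuous k (f : forall i, G -> Sym i G R^o)
    (g : forall i, G -> Sym i G E) x :
  (forall i, (i <= k)%N -> {for x, continuous (f i)}) ->
  (forall i, (i <= k)%N -> {for x, continuous (g i)}) ->
  {for x, continuous (fun y => leibniz k (f^~ y) (g^~ y))}.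
Proof.
move=> fc gc; apply: cvg_big => [|i _]; first exact: add_continuous.
apply: cvg_big => [|j _]; first exact: add_continuous.
have bc := @bounded_bilinear_cont _ _ _ _ (@shuffle k i j) (2 ^+ k)
  (@shuffle_linearr k i j) (fun v a u u' => shuffle_linearl k a u u' v) (@shuffle_norm k i j).
apply: (continuous2_cvg _ (bc (f i x, g j x))).
  by apply: fc; rewrite -ltnS.
by apply: gc; rewrite -ltnS.
Qed.

End SymProduct.

(** * Products and quotients of functions of class C^p *)
Lemma le_ord_leq j k p : (j <= k)%N -> le_ord k p -> le_ord j p.
Proof. by case: p => //= m; exact: leq_trans. Qed.

Section ProductRule.
Context {R : realType} {G E : normedModType R}.
Implicit Types (p : option nat) (X : set G).

Lemma is_Cp_scale_jet p X (f : G -> R^o) (g : G -> E) : open X ->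
  is_Cp p X f -> is_Cp p X g ->
  is_Cp p X (fun x => (f x : R) *: g x) /\
  (forall k, le_ord k p -> forall x, X x ->
     frechet_deriv (fun x => (f x : R) *: g x) k x =
     leibniz k (fun i => frechet_deriv f i x) (fun j => frechet_deriv g j x)).
Proof.
move=> oX Cf Cg.
apply: (@is_Cp_jet _ _ _ _ _ _ (fun k x =>
  leibniz k (fun i => frechet_deriv f i x) (fun j => frechet_deriv g j x))) => //.
- by move=> x _; rewrite /leibniz !big_ord1; exact: symP.
- move=> k kp x Xx.
  apply: is_diff_eq.
    apply: (@is_diff_leibniz _ _ _ k (frechet_deriv f)
      (fun i => sym_app (frechet_deriv f i.+1 x)) (frechet_deriv g)
      (fun i => sym_app (frechet_deriv g i.+1 x))) => i ik.
      by apply: (is_Cp_diff Cf) => //; apply: le_ord_leq kp.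
    by apply: (is_Cp_diff Cg) => //; apply: le_ord_leq kp.
  by apply/funext => h; rewrite leibniz_contract.
- move=> k kp x Xx; apply: leibniz_continuous => i ik.
    by apply: is_Cp_cont Cf _ _ => //; apply: le_ord_leq kp.
  by apply: is_Cp_cont Cg _ _ => //; apply: le_ord_leq kp.
Qed.

Lemma is_Cp_scale p X (f : G -> R^o) (g : G -> E) : open X ->
  is_Cp p X f -> is_Cp p X g -> is_Cp p X (fun x => (f x : R) *: g x).
Proof. by move=> oX Cf Cg; have [] := is_Cp_scale_jet oX Cf Cg. Qed.

Lemma sym_val0_bound i (S : Sym i G E) : `|S (fun=> 0)| <= 1 * `|S|.
Proof. by rewrite mul1r sym_val0_norm. Qed.

Lemma is_Cp_is_diff p X (f : G -> E) x : is_Cp p X f -> le_ord 1 p -> X x ->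
  is_diff x f (fun h => sym_app (frechet_deriv f 1 x) h (fun=> 0)).
Proof.
move=> Cf p1 Xx.
have vl : linear (fun S : Sym 0 G E => S (fun=> 0)) by [].
exact: (is_diff_linear vl (@sym_val0_bound 0) (is_Cp_diff Cf p1 Xx)).
Qed.

Lemma is_Cp_cont0 p X (f : G -> E) x : open X -> is_Cp p X f -> X x ->
  {for x, continuous f}.
Proof.
move=> oX Cf Xx; have p0 : le_ord 0 p by case: (p).
have fc := is_Cp_cont oX Cf p0 Xx.
have vc : continuous (fun S : Sym 0 G E => S (fun=> 0)).
  have vl : linear (fun S : Sym 0 G E => S (fun=> 0)) by [].
  pose vM := GRing.isLinear.Build _ _ _ _ _ vl.
  pose vL : {linear _ -> _} := HB.pack (fun S : Sym 0 G E => S (fun=> 0)) vM.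
  apply: (@bounded_linear_cont _ _ _ vL 1) => S; exact: sym_val0_bound.
exact: (continuous_cvg _ (vc _) fc).
Qed.

Lemma is_Cp_cont_const p X (f : G -> E) : open X -> ~~ le_ord 1 p ->
  (forall x, X x -> {for x, continuous f}) -> is_Cp p X f.
Proof.
move=> oX p1 fc.
have cc : continuous (@sym_const R G E).
  pose vM := GRing.isLinear.Build _ _ _ _ _ (@sym_const_linear R G E).
  pose vL : {linear _ -> _} := HB.pack (@sym_const R G E) vM.
  apply: (@bounded_linear_cont _ _ _ vL 1) => u.
  by rewrite mul1r -[X in X <= _]/(`|sym_const u|) sym_const_norm.
split=> k kp.
  by rewrite (le_ord_leq _ kp) in p1.
case: k kp => [|k] kp; last by rewrite (le_ord_leq _ kp) in p1.
apply/continuous_in_subspaceT => x /set_mem Xx.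
exact: (continuous_cvg _ (cc _) (fc _ Xx)).
Qed.

End ProductRule.

Section Quotient.
Context {R : realType} {G E : normedModType R}.

(** Let r = g / f be of class C^k.  The Leibniz formula for g = f r expresses
    D^k r through derivatives that are all differentiable, so D^k r is
    differentiable.  Its derivative is a symmetric form because it is the
    solution, for the unknown D^(k+1) r, of the Leibniz formula of order k+1. *)
Lemma is_Cp_quotient q (X : set G) (f : G -> R^o) (g : G -> E) : open X ->
  is_Cp (Some q) X f -> is_Cp (Some q) X g -> (forall x, X x -> (f x : R) != 0) ->
  is_Cp (Some q) X (fun x => (f x : R)^-1 *: g x).
Proof.
move=> oX; set r := fun x => _; elim: q => [|k IH] Cf Cg f0.
  apply: is_Cp_cont_const => // x Xx; apply: cvgZ.
    by apply: cvgV; [exact: f0|exact: (is_Cp_cont0 oX Cf)].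
  exact: (is_Cp_cont0 oX Cg).
have leS (j : nat) : le_ord j (Some k) -> le_ord j (Some k.+1) by exact: leqW.
have {IH}Cr : is_Cp (Some k) X r.
  by apply: IH => //; [apply: is_Cp_le Cf|apply: is_Cp_le Cg].
pose F x i := frechet_deriv f i x; pose D x j := frechet_deriv r j x.
have gE j x : (j <= k)%N -> X x -> frechet_deriv g j x = leibniz j (F x) (D x).
  move=> jk Xx; rewrite -(is_Cp_scale_jet oX _ Cr).2//; last exact: is_Cp_le Cf.
  apply: (frechet_deriv_eq_on oX) => // y Xy.
  by rewrite /r scalerA mulfV ?f0// scale1r.
pose B x := frechet_deriv g k x - leibniz k (F x) (truncate k (D x)).
pose C x := (f x : R)^-1 *:
  (frechet_deriv g k.+1 x - leibniz k.+1 (F x) (truncate k.+1 (D x))).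
have DE x : X x -> D x k = (f x : R)^-1 *: B x.
  move=> Xx; rewrite /B gE// leibniz_top addrK scalerA mulVf ?scale1r//.
  exact: f0.
have invd x : X x -> is_diff x (fun y => (f y : R)^-1 : R^o)
    (fun h => - (f x : R) ^- 2 *: (sym_app (F x 1%N) h (fun=> 0) : R)).
  move=> Xx; have [df dfE] := is_Cp_is_diff Cf (isT : le_ord 1 (Some k.+1)) Xx.
  apply: DiffDef; first exact: differentiableV df (f0 _ Xx).
  by rewrite (diffV df (f0 _ Xx)) dfE.
have Bd x : X x -> is_diff x B (fun h => sym_app (frechet_deriv g k.+1 x) h -
    (leibniz k (family_contract (F x) h) (truncate k (D x)) +
     leibniz k (F x) (family_contract (truncate k.+1 (D x)) h))).
  move=> Xx; have k1 : le_ord k.+1 (Some k.+1) by exact: leqnn.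
  refine (is_diffB (is_Cp_diff Cg k1 Xx) _).
  apply: (@is_diff_leibniz _ _ _ k (frechet_deriv f)
    (fun i h => family_contract (F x) h i) (fun j x => truncate k (D x) j)
    (fun i h => family_contract (truncate k.+1 (D x)) h i)) => i ik.
    by apply: (is_Cp_diff Cf).
  rewrite /truncate /family_contract ltnS; case: ifP => ik'; first exact: (is_Cp_diff Cr).
  apply: is_diff_eq.
  by apply/funext => h; rewrite [RHS]linear0l.
have Cd x : X x -> is_diff x (frechet_deriv r k) (sym_app (C x)).
  move=> Xx.
  apply: (@near_is_diff _ _ _ (fun y => (f y : R)^-1 *: B y)).
    have : \forall y \near x, X y by exact: open_nbhs_nbhs.
    by apply: filterS => y Xy; rewrite -DE.
  apply: is_diff_eq.
    apply: (is_diff_bilinear (U := R^o)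
      (f := fun a (T : Sym k G E) => (a : R) *: T) (M := 1) _ _ _ (invd x Xx) (Bd x Xx)).
    - by move=> u a v w; rewrite scalerDr !scalerA mulrC.
    - by move=> u a v w /=; rewrite scalerDl scalerA.
    - by move=> u v; rewrite normrZ mul1r.
  apply/funext => h; rewrite /C.
  move: (frechet_deriv g k.+1 x) => gk1 /=.
  rewrite linearZl /= linearBl /= leibniz_contract.
  have -> : leibniz k (family_contract (F x) h) (truncate k.+1 (D x)) = leibniz k (family_contract (F x) h) (D x).
    by apply: eq_leibniz => // j jk; rewrite /truncate ltnS jk.
  rewrite [in RHS]leibniz_top DE// -[family_contract (F x) h 0%N _]/(sym_app (F x 1%N) h (fun=> 0)).
  rewrite -addrA [in RHS]opprD addrCA [RHS]scalerDr; congr (_ + _).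
  rewrite scalerN !scalerA -scaleNr; congr (_ *: _).
  rewrite -[F x 1%N _]/(sym_app (F x 1%N) h (fun=> 0)) /GRing.scale /= expr2 invfM.
  by rewrite mulNr mulrAC.
have Cc x : X x -> {for x, continuous C}.
  move=> Xx; apply: cvgZ; first by apply: cvgV; [exact: f0|exact: (is_Cp_cont0 oX Cf)].
  apply: cvgB; first exact: (is_Cp_cont (k := k.+1) oX Cg (leqnn _) Xx).
  apply: (@leibniz_continuous _ _ _ k.+1 (frechet_deriv f)
    (fun j x => truncate k.+1 (D x) j)) => i ik.
    exact: (is_Cp_cont oX Cf).
  have -> : (fun y => truncate k.+1 (D y) i) =
      if (i <= k)%N then frechet_deriv r i else cst 0.
    by apply/funext => y; rewrite /truncate ltnS; case: ifP.
  by case: ifP => ik'; [exact: (is_Cp_cont oX Cr)|exact: cvg_cst].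
(* The jet of r, with C in degree k+1. *)
pose J j x : Sym j G E := @dfwith _ (fun j => Sym j G E) (D x) k.+1 (C x) j.
have JD j : j != k.+1 -> J j = frechet_deriv r j.
  by move=> jk; apply/funext => x; rewrite /J dfwithout// eq_sym.
have JC : J k.+1 = C by apply/funext => x; rewrite /J dfwithin.
have [] // := @is_Cp_jet _ _ _ (Some k.+1) X r J oX _ _ _.
- by move=> x _; rewrite JD.
- move=> j jk x Xx; move: (jk); rewrite /= ltnS leq_eqVlt => /orP[/eqP jE|jk'].
    by rewrite jE in jk *; rewrite JD ?ltn_eqF// JC; exact: Cd.
  by rewrite !JD ?ltn_eqF// 1?ltnW//; exact: (is_Cp_diff Cr).
- move=> j jk x Xx; move: (jk); rewrite /= leq_eqVlt => /orP[/eqP jE|jk'].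
    by rewrite jE in jk *; rewrite JC; exact: Cc.
  by rewrite JD ?ltn_eqF//; exact: (is_Cp_cont oX Cr).
Qed.

End Quotient.

(** * Composition with bounded linear maps, sums, products, determinants *)
Section PostComposition.
Context {R : realType} {G E E' : normedModType R}.
Variables (L : E -> E') (M : R).
Hypotheses (Ll : linear L) (LM : forall u, `|L u| <= M * `|u|).

Lemma sym_post_subproof k (S : Sym k G E) : (fun v => L (S v)) \in symml.
Proof.
rewrite inE; split=> [v i a x y|v s|].
- by rewrite sym_linear Ll.
- by rewrite sym_symmetric.
- have [S0 SM] := norm_bound_opnorm S.
  exists (`|M| * opnorm S); split=> [|v]; first exact: mulr_ge0.
  rewrite (le_trans (LM _))// (le_trans (ler_wpM2r _ (ler_norm M)))// -mulrA.
  by rewrite ler_wpM2l.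
Qed.

Definition sym_post k (S : Sym k G E) : Sym k G E' := MkSym _ (sym_post_subproof S).

Lemma sym_post_linear k : linear (@sym_post k).
Proof.
by move=> a S T; apply: symP => v; rewrite [RHS]/= -[LHS]/(L (a *: S v + T v)) Ll.
Qed.

Lemma sym_post_norm k (S : Sym k G E) : `|sym_post S| <= `|M| * `|S|.
Proof.
have [S0 SM] := norm_bound_opnorm S.
apply: opnorm_le; split=> [|v]; first exact: mulr_ge0.
rewrite (le_trans (LM _))// (le_trans (ler_wpM2r _ (ler_norm M)))// -mulrA.
by rewrite ler_wpM2l.
Qed.

Lemma is_Cp_post p (X : set G) (f : G -> E) : open X ->
  is_Cp p X f -> is_Cp p X (fun x => L (f x)).
Proof.
move=> oX Cf.
apply: (@is_Cp_jet _ _ _ p X _ (fun k x => sym_post (frechet_deriv f k x)) oX _ _ _).1.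
- by move=> x _; exact: symP.
- move=> k kp x Xx; apply: is_diff_eq.
    exact: (is_diff_linear (@sym_post_linear k) (@sym_post_norm k) (is_Cp_diff Cf kp Xx)).
  by apply/funext => h; exact: symP.
- move=> k kp x Xx.
  pose pM := GRing.isLinear.Build _ _ _ _ _ (@sym_post_linear k).
  pose pL : {linear _ -> _} := HB.pack (@sym_post k) pM.
  have pc : continuous pL by exact: (@bounded_linear_cont _ _ _ pL _ (@sym_post_norm k)).
  exact: (continuous_cvg _ (pc _) (is_Cp_cont oX Cf kp Xx)).
Qed.

End PostComposition.

Section PreComposition.
Context {R : realType} {G' G E : normedModType R}.
Variables (A : G' -> G) (M : R) (c : G).
Hypotheses (Al : linear A) (M0 : 0 <= M) (AM : forall u, `|A u| <= M * `|u|).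

Lemma pre_prod k (v : 'I_k -> G') : \prod_(i < k) `|A (v i)| <= M ^+ k * \prod_(i < k) `|v i|.
Proof.
rewrite -[X in M ^+ X](card_ord k) -prodr_const -big_split /=.
by apply: ler_prod => i _; rewrite normr_ge0 AM.
Qed.

Lemma sym_pre_subproof k (S : Sym k G E) : (fun v => S (A \o v)) \in symml.
Proof.
rewrite inE; split=> [v i a x y|v s|].
- have dA z : A \o dfwith v i z = dfwith (A \o v) i (A z).
    apply/funext => j /=; have [->|ij] := eqVneq i j; first by rewrite !dfwithin.
    by rewrite !dfwithout.
  by rewrite !dA Al sym_linear.
- exact: (sym_symmetric S (A \o v) s).
- have [S0 SM] := norm_bound_opnorm S.
  exists (opnorm S * M ^+ k); split=> [|v]; first by rewrite mulr_ge0 ?exprn_ge0.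
  by rewrite (le_trans (SM _))// -mulrA ler_wpM2l// pre_prod.
Qed.

Definition sym_pre k (S : Sym k G E) : Sym k G' E := MkSym _ (sym_pre_subproof S).

Lemma sym_pre_linear k : linear (@sym_pre k).
Proof. by move=> a S T; apply: symP => v. Qed.

Lemma sym_pre_norm k (S : Sym k G E) : `|sym_pre S| <= M ^+ k * `|S|.
Proof.
have [S0 SM] := norm_bound_opnorm S.
apply: opnorm_le; split=> [|v]; first by rewrite mulr_ge0 ?exprn_ge0.
by rewrite (le_trans (SM _))// (mulrC (M ^+ k)) -mulrA ler_wpM2l// pre_prod.
Qed.

Lemma is_Cp_pre_jet p (X : set G) (X' : set G') (f : G -> E) : open X -> open X' ->
  (forall x, X' x -> X (A x + c)) -> is_Cp p X f ->
  is_Cp p X' (fun x => f (A x + c)) /\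
  (forall k, le_ord k p -> forall x, X' x ->
    frechet_deriv (fun x => f (A x + c)) k x = sym_pre (frechet_deriv f k (A x + c))).
Proof.
move=> oX oX' XX' Cf.
have dA x : is_diff x (fun y => A y + c) A.
  have -> : (fun y => A y + c) = (A \o id) + cst c by [].
  apply: is_diff_eq.
    exact: (is_diffD (is_diff_linear Al AM (is_diff_id x)) (is_diff_cst c x)).
  by rewrite addr0.
apply: (@is_Cp_jet _ _ _ p X' _ (fun k x => sym_pre (frechet_deriv f k (A x + c))) oX').
- by move=> x _; exact: symP.
- move=> k kp x Xx; apply: is_diff_eq.
    have := is_diff_comp (dA x) (is_Cp_diff Cf kp (XX' _ Xx)).
    exact: (is_diff_linear (@sym_pre_linear k) (@sym_pre_norm k)).
  move: (frechet_deriv f k.+1 _) => S; apply/funext => h; apply: symP => v /=.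
  congr (S _); apply/funext => i /=.
  by rewrite /consf; case: unlift.
- move=> k kp x Xx.
  pose pM := GRing.isLinear.Build _ _ _ _ _ (@sym_pre_linear k).
  pose pL : {linear _ -> _} := HB.pack (@sym_pre k) pM.
  have pc : continuous pL by exact: (@bounded_linear_cont _ _ _ pL _ (@sym_pre_norm k)).
  apply: (continuous_cvg _ (pc _)).
  have Ac : {for x, continuous (fun y => A y + c)} by exact: (is_diff_continuous (dA x)).
  exact: (continuous_cvg _ (is_Cp_cont oX Cf kp (XX' _ Xx)) Ac).
Qed.

End PreComposition.

Section ScalarFunctions.
Context {R : realType} {G : normedModType R}.
Implicit Types (p : option nat) (X : set G).

Lemma is_Cp_cst (E : normedModType R) p X (u : E) : is_Cp p X (fun=> u).
Proof. exact: (sym_pow_is_Cp p X (sym_const u) 0). Qed.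

Lemma is_CpD (E : normedModType R) p X (f g : G -> E) : open X ->
  is_Cp p X f -> is_Cp p X g -> is_Cp p X (fun x => f x + g x).
Proof.
move=> oX Cf Cg; have := is_Cp_linear 1 oX Cf Cg.
by rewrite scale1r.
Qed.

Lemma is_CpM p X (f g : G -> R^o) : open X ->
  is_Cp p X f -> is_Cp p X g -> is_Cp p X (fun x => f x * g x : R^o).
Proof. by move=> oX Cf Cg; exact: is_Cp_scale. Qed.

Lemma is_Cp_sum (E : normedModType R) p X (I : finType) (f : I -> G -> E) :
  open X -> (forall i, is_Cp p X (f i)) -> is_Cp p X (fun x => \sum_i f i x).
Proof.
move=> oX Cf.
suff H (r : seq I) : is_Cp p X (fun x => \sum_(i <- r) f i x) by [].
elim: r => [|i r IH].
  rewrite (_ : (fun x => _) = fun=> 0); first exact: is_Cp_cst.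
  by apply/funext => x; rewrite big_nil.
rewrite (_ : (fun x => _) = fun x => f i x + \sum_(i <- r) f i x); last first.
  by apply/funext => x; rewrite big_cons.
exact: is_CpD.
Qed.

Lemma is_Cp_prod p X (I : finType) (f : I -> G -> R^o) :
  open X -> (forall i, is_Cp p X (f i)) -> is_Cp p X (fun x => \prod_i (f i x : R) : R^o).
Proof.
move=> oX Cf.
suff H (r : seq I) : is_Cp p X (fun x => \prod_(i <- r) (f i x : R) : R^o) by [].
elim: r => [|i r IH].
  rewrite (_ : (fun x => _) = fun=> (1 : R)); first exact: is_Cp_cst.
  by apply/funext => x; rewrite big_nil.
rewrite (_ : (fun x => _) = fun x => f i x * \prod_(i <- r) (f i x : R)); last first.
  by apply/funext => x; rewrite big_cons.
exact: is_CpM.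
Qed.

Lemma is_Cp_det p X m (f : G -> 'M[R]_m) : open X ->
  (forall i j, is_Cp p X (fun x => f x i j : R^o)) ->
  is_Cp p X (fun x => \det (f x) : R^o).
Proof.
move=> oX Cf; apply: is_Cp_sum => // s; apply: is_CpM => //.
  exact: is_Cp_cst.
by apply: (@is_Cp_prod p X _ (fun i x => f x i (s i) : R^o)).
Qed.

End ScalarFunctions.

(** * A plateau function of finite differentiability *)
Section OneVariable.
Context {R : realType}.

Lemma is_diff_flat (V W : normedModType R) (f : V -> W) x :
  (forall e, 0 < e -> \forall h \near (0 : V), `|f (h + x) - f x| <= e * `|h|) ->
  is_diff x f 0.
Proof.
move=> fx.
have fE : f \o shift x = cst (f x) + (\0 : V -> W) +o_ (0 : V) id.
  apply/eqaddoP => e e0; apply: filterS (fx e e0) => h /=.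
  by rewrite !fctE /= addr0.
have dc : continuous (\0 : {linear V -> W}) by exact: cst_continuous.
have dE := diff_unique dc fE.
by split; [apply/diff_locallyP; rewrite dE|].
Qed.

(** The m-th power of the positive part of x. *)
Definition ramp m (x : R) : R := Num.max x 0 ^+ m.

Lemma is_diff_ramp m (x : R^o) :
  is_diff x (ramp m.+2 : R^o -> R^o) (fun h : R^o => m.+2%:R * ramp m.+1 x * h : R^o).
Proof.
have [x0|x0|->] := ltgtP x 0.
- apply: (@near_is_diff _ _ _ (cst (0 : R^o))).
    have : \forall y \near x, y < 0 by exact: lt_nbhsl.
    by apply: filterS => y y0; rewrite /ramp max_r ?expr0n// ltW.
  apply: is_diff_eq; apply/funext => h.
  by rewrite /ramp (max_r (ltW x0)) expr0n mulr0 mul0r.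
- apply: (@near_is_diff _ _ _ ((fun y : R^o => y) ^+ m.+2 : R^o -> R^o)).
    have : \forall y \near x, 0 < y by exact: lt_nbhsr.
    by apply: filterS => y y0; rewrite /ramp max_l ?ltW// exprfctE.
  apply: is_diff_eq.
  by apply/funext => h; rewrite /ramp (max_l (ltW x0)) !fctE.
- rewrite (_ : (fun h => _) = 0); last first.
    by apply/funext => h; rewrite /ramp maxxx expr0n mulr0 mul0r.
  have near_le (d : R) : 0 < d -> \forall h \near (0 : R^o), `|h : R| <= d.
    by move=> d0; exact: (@nbhs0_le _ R^o).
  apply: is_diff_flat => e e0; near=> h; rewrite addr0 /ramp maxxx expr0n subr0.
  have hm : `|Num.max h 0| <= `|h| by rewrite /Num.max; case: ifP; rewrite ?normr0.
  have h1 : `|h| <= 1 by near: h; exact: near_le.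
  have he : `|h| <= e by near: h; exact: near_le.
  rewrite normrX (le_trans (lerXn2r _ _ _ hm)) ?nnegrE// exprS exprS mulrCA mulrA.
  rewrite mulrC mulrA ler_wpM2r// -[leRHS]mul1r ler_pM ?exprn_ge0//.
  by rewrite exprn_ile1.
Unshelve. all: by end_near. Qed.

Lemma prodform_subproof k : (fun v : 'I_k -> R^o => \prod_i (v i : R) : R^o) \in symml.
Proof.
rewrite inE; split=> [v i a x y|v s|].
- have P z : \prod_(j < k) (dfwith v i z j : R) = z * \prod_(j < k | j != i) (v j : R).
    rewrite (bigD1 i)//= dfwithin; congr (_ * _).
    by apply: eq_bigr => j ji; rewrite dfwithout// eq_sym.
  by rewrite !P mulrDl -mulrA.
- by rewrite [RHS](reindex_inj (@perm_inj _ s)).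
- by exists 1; split=> // v; rewrite mul1r normr_prod.
Qed.

(** The k-th derivative of a function of one real variable is a multiple of this
    form. *)
Definition prodform k : Sym k R^o R^o := MkSym _ (prodform_subproof k).

(** The exponent P + 2 makes the derivative of order P still differentiable, so
    that its continuity needs no separate argument. *)
Lemma ramp_is_Cp P : is_Cp (Some P) setT (ramp P.+2 : R^o -> R^o).
Proof.
pose D k (x : R^o) : Sym k R^o R^o :=
  ((P.+2 ^_ k)%:R * ramp (P.+2 - k) x : R) *: prodform k.
have dD k : (k <= P)%N -> forall x, is_diff x (D k) (sym_app (D k.+1 x)).
  move=> kP x.
  have kE : (P.+2 - k = (P - k).+2)%N by rewrite -!subSn// leqW.
  have Ll : linear (fun r : R^o => ((P.+2 ^_ k)%:R * r : R) *: prodform k).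
    by move=> a u v; rewrite mulrDr scalerDl mulrCA scalerA.
  have LM (r : R^o) : `|((P.+2 ^_ k)%:R * r : R) *: prodform k| <=
      `|(P.+2 ^_ k)%:R : R| * `|prodform k| * `|r|.
    by rewrite normrZ normrM mulrAC.
  apply: is_diff_eq.
    rewrite /D kE; exact: (is_diff_linear Ll LM (is_diff_ramp (P - k) x)).
  have kE1 : (P.+2 - k.+1 = (P - k).+1)%N by rewrite subSS subSn.
  apply/funext => h; apply: symP => v.
  rewrite /D /= !fctE /= [in RHS]big_ord_recl consf0 kE1.
  under [in RHS]eq_bigr do rewrite consfS.
  by rewrite ffactnSr kE natrM /GRing.scale /= !mulrA.
apply: (@is_Cp_jet _ _ _ (Some P) setT _ D openT _ _ _).1.
- move=> x _; apply: symP => v; rewrite /D /= subn0 ffactn0 mul1r.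
  by rewrite fctE big_ord0 /GRing.scale /= mulr1.
- by move=> k kP x _; apply: dD; exact: ltnW.
- by move=> k kP x _; exact: is_diff_continuous (dD k kP x).
Qed.

Lemma ramp_ge0 m x : 0 <= ramp m x.
Proof. by rewrite exprn_ge0// le_max lexx orbT. Qed.

Lemma ramp_gt0 m x : 0 < x -> 0 < ramp m x.
Proof. by move=> x0; rewrite exprn_gt0// lt_max x0. Qed.

Lemma ramp0 m x : x <= 0 -> ramp m.+1 x = 0.
Proof. by move=> x0; rewrite /ramp max_r// expr0n. Qed.

Definition smoothstep P (x : R^o) : R^o :=
  (ramp P.+2 x + ramp P.+2 (1 - x))^-1 * ramp P.+2 x.

Lemma smoothstep_is_Cp P : is_Cp (Some P) setT (smoothstep P).
Proof.
have oT : open [set: R^o] by exact: openT.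
apply: (@is_Cp_quotient R R^o R^o P setT
  (fun x : R^o => ramp P.+2 x + ramp P.+2 (1 - x) : R^o)) => //.
- apply: is_CpD => //; first exact: ramp_is_Cp.
  rewrite (_ : (fun x => _) = (fun x => ramp P.+2 (-%R x + 1))); last first.
    by apply/funext => x; rewrite addrC.
  apply: (is_Cp_pre_jet (G' := R^o) (G := R^o) (A := -%R) (M := 1) _ _ _
    oT oT _ (ramp_is_Cp P)).1 => //.
  + by move=> a u v; rewrite opprD scalerN.
  + by move=> u; rewrite normrN mul1r.
- exact: ramp_is_Cp.
- move=> x _; rewrite gt_eqF//; have [x0|x0] := leP x 0.
    by rewrite ltr_wpDl ?ramp_ge0// ramp_gt0// subr_gt0 (le_lt_trans x0).
  by rewrite ltr_wpDr ?ramp_ge0// ramp_gt0.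
Qed.

Lemma smoothstep0 P x : x <= 0 -> smoothstep P x = 0.
Proof. by move=> x0; rewrite /smoothstep ramp0// mulr0. Qed.

Lemma smoothstep1 P x : 1 <= x -> smoothstep P x = 1.
Proof.
move=> x1; rewrite /smoothstep (@ramp0 _ (1 - x)) ?subr_le0// addr0 mulVf//.
by rewrite gt_eqF// ramp_gt0// (lt_le_trans _ x1).
Qed.

End OneVariable.

Section Plateau.
Context {R : realType} {n : nat}.
Local Notation V := 'rV[R]_n.

Lemma coord_linear (a : R) i : linear (fun x : V => a * x ord0 i : R^o).
Proof. by move=> b x y; rewrite !mxE mulrDr mulrCA. Qed.

Lemma coord_bound (a : R) i (x : V) : `|a * x ord0 i : R^o| <= `|a| * `|x|.
Proof. by rewrite normrM ler_wpM2l// rV_entry_norm. Qed.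

Lemma is_Cp_coord p (X : set V) i (a : R) : open X ->
  is_Cp p X (fun x => x ord0 i - a : R^o).
Proof.
move=> oX; pose lam j : nat := (j == i)%:R.
have := sym_pow_is_Cp p X (mono_form lam (1 : R^o)) (\row_ _ a).
apply: is_Cp_eq => // x _; rewrite mono_formE (bigD1 i)//= big1 => [|j /negPf ji].
  by rewrite /lam eqxx expr1 mulr1 !mxE; exact: mulr1.
by rewrite /lam ji expr0.
Qed.

Definition plateau P (x : V) : R^o :=
  \prod_i (smoothstep P (2 + x ord0 i) * smoothstep P (2 - x ord0 i) : R).

Lemma plateau_is_Cp P : is_Cp (Some P) setT (plateau P).
Proof.
have oV : open [set: V] by exact: openT.
have oT : open [set: R^o] by exact: openT.
have H i (a : R) : is_Cp (Some P) setT (fun x : V => smoothstep P (a * x ord0 i + 2)).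
  apply: (is_Cp_pre_jet (A := fun x : V => a * x ord0 i : R^o) (c := 2 : R^o)
    (coord_linear a i) (normr_ge0 _) (coord_bound a i) oT oV _ (smoothstep_is_Cp P)).1 => //.
apply: is_Cp_prod => // i; apply: is_CpM => //.
  by apply: is_Cp_eq (H i 1) => // x _; rewrite mul1r addrC.
by apply: is_Cp_eq (H i (-1)) => // x _; rewrite mulN1r addrC.
Qed.

Lemma plateau1 P x : `|x| <= 1 -> plateau P x = 1.
Proof.
move=> x1; rewrite /plateau big1// => i _.
have := le_trans (rV_entry_norm x i) x1; rewrite ler_norml => /andP[x1' x1''].
by rewrite !smoothstep1 ?mulr1//; lra.
Qed.

Lemma plateau0 P (x : V) i : 2 <= `|x ord0 i| -> plateau P x = 0.
Proof.
move=> x2; rewrite /plateau (bigD1 i)//=.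
suff -> : smoothstep P (2 + x ord0 i) * smoothstep P (2 - x ord0 i) = 0 by rewrite mul0r.
have [x0|x0] := leP 0 (x ord0 i).
  by rewrite [X in _ * X]smoothstep0 ?mulr0// subr_le0 -(ger0_norm x0).
rewrite [X in X * _]smoothstep0 ?mul0r//.
by rewrite -[x ord0 i]opprK subr_le0 -(ltr0_norm x0).
Qed.

End Plateau.

(** * The topology of C^p(X, E) *)
Section CpTopology.
Context {R : realType} {G E : normedModType R} {p : option nat}.
Context {X : set G} {oX : open X}.
Local Notation Cp := (Cp p oX E).

Lemma Cp_semiball_open (U : set Cp) : Cp_open_semiball U -> open U.
Proof.
move=> sU.
exists [set U]; last by rewrite bigcup_set1.
move=> _ ->; exists [fset U]%fset; first by move=> V; rewrite in_fset1 => /eqP ->; exact/mem_set.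
by apply/seteqP; split=> [g /(_ U)|g Ug V]; rewrite /= in_fset1; [apply|move=> /eqP ->].
Qed.

Lemma Cp_cvg (I : Type) (F : set_system I) (f : I -> Cp) (g : Cp) : Filter F ->
  (forall U, Cp_open_semiball U -> U g -> \forall i \near F, U (f i)) ->
  f i @[i --> F] --> g.
Proof.
move=> FF fU N; rewrite nbhsE => -[Q [[D sDO <-] [B DB Bg]] QN].
have [S SD SB] := sDO _ DB.
have SU : \forall i \near F, forall V, V \in S -> V (f i).
  have [s sE] : exists s : seq (set Cp), forall V, (V \in S) = (V \in s).
    by exists (enum_fset S).
  have sg V : V \in s -> Cp_open_semiball V /\ V g.
    move=> Vs; have VS : V \in S by rewrite sE.
    by split; [apply/set_mem; exact: SD|move: Bg; rewrite -SB; exact].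
  suff : \forall i \near F, forall V, V \in s -> V (f i).
    by apply: filterS => i H V; rewrite sE; exact: H.
  elim: s sg {sE} => [|W s IH] sg; first by apply: nearW => i V; rewrite in_nil.
  have [oW Wg] := sg W (mem_head _ _).
  have {}IH : \forall i \near F, forall V, V \in s -> V (f i).
    by apply: IH => V Vs; apply: sg; rewrite in_cons Vs orbT.
  apply: filterS2 (fU _ oW Wg) IH => i Wi Hi V; rewrite in_cons => /orP[/eqP->//|].
  exact: Hi.
apply: filterS SU => i Si; apply: QN; exists B => //.
suff : B (f i) by []; rewrite -SB => V; exact: Si.
Qed.

Lemma Cp_deriv_bounded (f : Cp) K k : compact K -> K `<=` X -> le_ord k p ->
  exists M, forall x j, K x -> (j <= k)%N -> `|frechet_deriv f j x| <= M.
Proof.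
move=> cK KX; elim: k => [|k IH] kp.
  have fc : {within K, continuous (frechet_deriv f 0)}.
    exact: continuous_subspaceW KX ((Cp_is_Cp f).2 _ kp).
  have [N [_ NM]] := compact_bounded (continuous_compact fc cK).
  exists (N + 1) => x j Kx; rewrite leqn0 => /eqP ->.
  by apply: NM; [rewrite ltrDl|exists x].
have [M HM] := IH (le_ordW kp).
have fc : {within K, continuous (frechet_deriv f k.+1)}.
  exact: continuous_subspaceW KX ((Cp_is_Cp f).2 _ kp).
have [N [_ NM]] := compact_bounded (continuous_compact fc cK).
exists (Num.max M (N + 1)) => x j Kx; rewrite leq_eqVlt => /orP[/eqP ->|jk].
  by rewrite le_max; apply/orP; right; apply: NM; [rewrite ltrDl|exists x].
by rewrite le_max HM.
Qed.

Lemma Cp_derivD (f g : Cp) a k x : le_ord k p -> X x ->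
  frechet_deriv (a *: f + g : Cp) k x = a *: frechet_deriv f k x + frechet_deriv g k x.
Proof.
move=> kp Xx.
exact: (frechet_deriv_linear a oX (Cp_is_Cp f) (Cp_is_Cp g) kp Xx).
Qed.

(** The subbase of the topology consists of semiballs with arbitrary centers g,
    so the radius left around 0 is e minus the seminorm of g. *)
Lemma Cp_cvg0 (I : Type) (F : set_system I) (f : I -> Cp) : ProperFilter F ->
  (forall K k e, compact K -> K `<=` X -> le_ord k p -> 0 < e ->
    \forall i \near F, forall x j, K x -> (j <= k)%N -> `|frechet_deriv (f i) j x| <= e) ->
  f i @[i --> F] --> (0 : Cp).
Proof.
move=> FF fe; apply: Cp_cvg => _ [K [k [g [e [cK KX kp e0 ->]]]]] /=.
set s := Cp_seminorm K k (0 - g) => se.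
apply: filterS (fe K k ((e - s) / 2) cK KX kp _) => [i Hi|]; last first.
  by rewrite divr_gt0// subr_gt0.
have [->|/set0P[x0 Kx0]] := eqVneq K set0.
  rewrite /Cp_seminorm (_ : [set _ | _] = set0) ?sup0//.
  by apply/seteqP; split=> // r [x [j []]].
apply: (@le_lt_trans _ _ (s + (e - s) / 2)); last by lra.
apply: sup_le_ub.
  by exists `|frechet_deriv (f i - g) 0 x0|, x0, 0%N.
move=> _ [x [j [Kx jk ->]]].
have Xx := KX _ Kx; have jp := le_ord_leq jk kp.
have -> : frechet_deriv (f i - g) j x =
    frechet_deriv (f i) j x + frechet_deriv (0 - g) j x.
  have -> : f i - g = 1 *: f i + (0 - g) by rewrite scale1r sub0r.
  by rewrite Cp_derivD// scale1r.
rewrite (le_trans (ler_normD _ _))// addrC lerD//; last exact: Hi.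
apply: ub_le_sup; last by exists x, j.
have [M HM] := Cp_deriv_bounded (0 - g) cK KX kp.
by exists M => _ [x' [j' [Kx' jk' ->]]]; exact: HM.
Qed.

Lemma Cp_eval_continuous y : X y -> {for 0, continuous (fun f : Cp => f y)}.
Proof.
move=> Xy N /nbhs_ballP[e /= e0 eN].
have p0 : le_ord 0 p by case: (p).
have oU : open [set g : Cp | Cp_seminorm [set y] 0 (g - 0) < e].
  apply: Cp_semiball_open; exists [set y], 0%N, 0, e; split=> //.
    exact: compact_set1.
  by move=> _ ->.
have sE (g : Cp) : Cp_seminorm [set y] 0 g = `|g y|.
  rewrite /Cp_seminorm (_ : [set _ | _] = [set `|g y|]) ?sup1//.
  apply/seteqP; split=> r /=.
    by move=> [x [j [-> + ->]]]; rewrite leqn0 => /eqP ->; rewrite sym_const_norm.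
  by move=> ->; exists y, 0%N; rewrite sym_const_norm.
have : nbhs (0 : Cp) [set g : Cp | Cp_seminorm [set y] 0 (g - 0) < e].
  by apply: open_nbhs_nbhs; split=> //=; rewrite sE subr0 normr0.
apply: filterS => g /=; rewrite subr0 sE => ge; apply: eN.
by rewrite -ball_normE /= sub0r normrN.
Qed.

End CpTopology.

(** * Values of T on functions that are flat at h(y) *)
Section Flatness.
Context {R : realType} {H E F : normedModType R} {n P : nat} {q : option nat}.
Local Notation V := 'rV[R]_n.
Context {X : set V} {oX : open X} {Y : set H} {oY : open Y}.
Variable T : {linear Cp (Some P) oX E -> Cp q oY F}.
Hypothesis T_continuous : continuous T.
Variable (h : H -> V).
Hypothesis h_support : is_support_map T h.

Lemma coord_attained (x : V) e : 0 < e -> e <= `|x| -> exists i, e <= `|x ord0 i|.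
Proof.
move=> e0 ex.
have /mx_norm_neq0 [[i j] /= xE] : mx_norm x != 0.
  by rewrite -[mx_norm x]/(`|x|) gt_eqF// (lt_le_trans e0).
by exists j; have -> : ord0 = i; [exact/val_inj/esym/(congr1 val (ord1 i))|rewrite -xE].
Qed.

Lemma scale_shift_is_Cp (W : normedModType R) (d : R) (c : V) (X' : set V)
    (f : V -> W) :
  open X' -> is_Cp (Some P) setT f ->
  is_Cp (Some P) X' (fun x => f (d *: (x - c))) /\
  (forall k, (k <= P)%N -> forall x, X' x ->
    `|frechet_deriv (fun x => f (d *: (x - c))) k x| <=
      `|d| ^+ k * `|frechet_deriv f k (d *: (x - c))|).
Proof.
move=> oX' Cf.
have E1 x : d *: (x - c) = d *: x + - (d *: c) by rewrite scalerBr.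
have dl : linear (fun x : V => d *: x).
  by move=> a u v; rewrite scalerDr !scalerA mulrC.
have db (u : V) : `|d *: u| <= `|d| * `|u| by rewrite normrZ.
have fE : (fun x => f (d *: (x - c))) = (fun x => f (d *: x + - (d *: c))).
  by apply/funext => x; rewrite E1.
have [C1 C2] := is_Cp_pre_jet (c := - (d *: c)) dl (normr_ge0 d) db
  openT oX' (fun _ _ => I) Cf.
rewrite fE; split=> // k kP x Xx; rewrite C2// E1; exact: sym_pre_norm.
Qed.

(** Let psi be 1 at h(y) and 0 on the support of f.  The open set where the
    coordinate psi is finite and less than 1/2 contains the closed support of f:
    there the coordinate psi is 0, the point at infinity being excluded because
    it has a neighbourhood that omits 0.  If Tf(y) were not 0, this open set
    would belong to O_y, but its closure misses h(y). *)
Lemma vanish_near_support y (f : Cp (Some P) oX E) e : Y y -> 0 < e ->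
  (forall x, X x -> `|x - h y| < e -> f x = 0) -> T f y = 0.
Proof.
move=> Yy e0 f0; apply: contrapT => Tfy.
have [Xhy hE] := h_support Yy.
pose psif (x : V) : R^o := plateau P ((2 / e) *: (x - h y)).
have Cpsi : is_Cp (Some P) X psif.
  exact: (scale_shift_is_Cp (2 / e) (h y) oX (plateau_is_Cp (n := n) P)).1.
pose psi := Cp_restrict oX Cpsi.
have psi1 : psi (h y) = 1.
  by rewrite Cp_restrictE// /psif subrr scaler0 plateau1// normr0.
have psi0 x : X x -> f x <> 0 -> psi x = 0.
  move=> Xx fx; rewrite Cp_restrictE// /psif.
  have : e <= `|x - h y| by rewrite leNgt; apply/negP => /(f0 _ Xx).
  move=> /(coord_attained e0)[i ei]; apply: (@plateau0 _ _ _ _ i).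
  rewrite mxE normrM gtr0_norm ?divr_gt0// -ler_pdivrMl ?divr_gt0//.
  by rewrite invf_div divfK.
pose ev (a : {ptws Cp (Some P) oX R^o -> one_point_compactification R}) := a psi.
have evc : continuous ev.
  exact: (@proj_continuous _ (fun=> one_point_compactification R) psi).
have openlt (A : set R) : open A -> open (ev @^-1` (Some @` A)).
  move=> oA; apply: open_comp => [a _|]; first exact: evc.
  exact: one_point_compactification_open_some.
pose O1 := ev @^-1` (Some @` [set r : R | r < 2^-1]).
pose O2 := ev @^-1` (Some @` [set r : R | 2^-1 < r]).
have oO1 : open O1 by apply: openlt; exact: open_lt.
have oO2 : open O2 by apply: openlt; exact: open_gt.
pose W := @compactification R V (Some P) X oX `&` O1.
have WS : support_family T y W.
  split; first by exists O1.
  exists f => // a [ca cla]; split=> //; rewrite /O1 /=.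
  suff -> : ev a = Some 0 by exists 0.
  case ea : (ev a) => [r|].
    apply/eqP; apply/negP => /negP r0.
    have oU : open (ev @^-1` (Some @` [set s : R | s != 0])).
      by apply: openlt; exact: open_neq.
    have aU : (ev @^-1` (Some @` [set s : R | s != 0])) a.
      exists r; rewrite ?ea//=; apply: contraNneq r0 => ->//.
    have [_ [[x [Xx fx] <-] [s /= s0]]] := cla _ (open_nbhs_nbhs (conj oU aU)).
    by rewrite /ev /embed psi0// => -[/eqP]; rewrite (negPf s0).
  have N : nbhs (None : one_point_compactification R)
      ((Some @` ~` [set (0 : R)]) `|` [set None]).
    by exists [set 0] => //; split; [exact: compact_set1|exact: closed_eq].
  have aU : nbhs a (ev @^-1` ((Some @` ~` [set (0 : R)]) `|` [set None])).
    by apply: evc; rewrite ea.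
  have [_ [[x [Xx fx] <-] /= [[s s0]|]]] := cla _ aU; rewrite /ev /embed psi0//.
  by move=> [/s0].
have : (\bigcap_(W in support_family T y) relative_closure W) (embed (h y)) by rewrite hE.
move=> /(_ _ WS)[_ clW].
have aO2 : O2 (embed (h y)).
  exists 1; last by rewrite /ev /embed psi1.
  by rewrite /= invf_lt1// ltr1n.
have [a [[_ [r r1 ar]] [s s1]]] := clW _ (open_nbhs_nbhs (conj oO2 aO2)).
rewrite -ar => -[sr]; move: r1 s1 => /=; rewrite sr => r1 /(lt_trans r1).
by rewrite ltxx.
Qed.

Section CutOff.
Variables (lam : 'I_n -> nat) (u : E).
Local Notation L := (\sum_(i < n) lam i)%N.

Definition cut_monomial (x : V) : E :=
  ((\prod_i x ord0 i ^+ lam i) * plateau P x : R) *: u.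

Lemma monomial_is_Cp p (X' : set V) (c : V) : open X' ->
  is_Cp p X' (fun x => \prod_i (x ord0 i - c ord0 i) ^+ lam i : R^o).
Proof.
move=> oX'; have := sym_pow_is_Cp p X' (mono_form lam (1 : R^o)) c.
apply: is_Cp_eq => // x _; rewrite mono_formE /GRing.scale /= mulr1.
by apply: eq_bigr => i _; rewrite !mxE.
Qed.

Lemma scaleu_linear : linear (fun r : R^o => (r : R) *: u).
Proof. by move=> a r s; rewrite scalerDl scalerA. Qed.

Lemma scaleu_bound (r : R^o) : `|(r : R) *: u| <= `|u| * `|r|.
Proof. by rewrite normrZ mulrC. Qed.

Lemma cut_monomial_is_Cp : is_Cp (Some P) setT cut_monomial.
Proof.
apply: (is_Cp_post scaleu_linear scaleu_bound openT).
apply: (is_CpM openT); last exact: plateau_is_Cp.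
have := monomial_is_Cp (Some P) 0 openT.
by apply: is_Cp_eq => [|x _]; [exact: openT|apply: eq_bigr => i _; rewrite mxE subr0].
Qed.

Lemma cut_monomial_bounded : exists M, 0 <= M /\
  forall x j, (j <= P)%N -> `|frechet_deriv cut_monomial j x| <= M.
Proof.
(* The cube outside which the plateau function vanishes. *)
pose K : set V := [set x | forall i, x ord0 i \in `[-2, 2]].
have cK : compact K.
  apply: (@rV_compact R n (fun=> [set r : R | r \in `[-2, 2]])) => i.
  exact: segment_compact.
have oK : open (~` K).
  by apply: closed_openC; apply: compact_closed cK; exact: norm_hausdorff.
pose B := Cp_restrict openT cut_monomial_is_Cp.
have [M HM] := Cp_deriv_bounded B cK (fun _ _ => I) (leqnn P : le_ord P (Some P)).
exists `|M|; split=> // x j jP.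
have [Kx|Kx] := pselect (K x).
  rewrite (le_trans _ (ler_norm M))// (le_trans _ (HM x j Kx jP))//.
  by rewrite le_eqVlt (frechet_deriv_eq_on openT (g := B)) ?eqxx// => z _; rewrite Cp_restrictE.
have B0 z : ~ K z -> cut_monomial z = (0 : V -> E) z.
  move=> Kz; rewrite /cut_monomial.
  suff [i zi] : exists i, 2 <= `|z ord0 i| by rewrite (plateau0 _ zi) mulr0 scale0r.
  apply: contrapT => nz; apply: Kz => i /=; rewrite in_itv /= -ler_norml.
  by rewrite leNgt; apply/negP => /ltW zi; apply: nz; exists i.
by rewrite (frechet_deriv_eq_on oK B0)// frechet_deriv_cst0 normr0.
Qed.

(** By [vanish_near_support], T takes the same value at y on the monomial and on
    its rescaled truncation f_d(x) = d^L b((x - c) / d), for each d > 0.  Since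
    D^j f_d is bounded by d^(L - j) times the bound of D^j b and j <= P < L, f_d
    tends to 0 in C^P(X, E) as d tends to 0. *)
Lemma monomial_eq0_finite_order y (Cg : is_Cp (Some P) X
    (fun x => (\prod_i (x ord0 i - h y ord0 i) ^+ lam i) *: u)) :
  Y y -> (P < L)%N -> T (Cp_restrict oX Cg) y = 0.
Proof.
move=> Yy PL; set c := h y; set g := Cp_restrict oX Cg.
pose S d := scale_shift_is_Cp d c oX cut_monomial_is_Cp.
pose s d : Cp (Some P) oX E := Cp_restrict oX (S d).1.
pose f d : Cp (Some P) oX E := d ^+ L *: s d^-1.
have fE d x : X x -> f d x = d ^+ L *: cut_monomial (d^-1 *: (x - c)).
  by move=> Xx; rewrite -[f d x]/(d ^+ L *: (s d^-1 x)) /s Cp_restrictE.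
have Tf d : 0 < d -> T g y = T (f d) y.
  move=> d0; apply/eqP; rewrite -subr_eq0; apply/eqP.
  rewrite -[LHS]/((T g - T (f d)) y) -linearB.
  apply: (@vanish_near_support y _ d) => // x Xx xd.
  rewrite -[LHS]/(g x - f d x) fE// Cp_restrictE// /cut_monomial plateau1; last first.
    by rewrite normrZ normfV gtr0_norm// mulrC ler_pdivrMr// mul1r ltW.
  rewrite mulr1 scalerA; apply/eqP; rewrite subr_eq0; apply/eqP; congr (_ *: u).
  rewrite -prodrXr -big_split /=; apply: eq_bigr => i _.
  by rewrite !mxE -exprMn mulVKf ?gt_eqF.
have [M [M0 HM]] := cut_monomial_bounded.
have fder d x j : 0 < d -> d <= 1 -> X x -> (j <= P)%N ->
    `|frechet_deriv (f d) j x| <= d * M.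
  move=> d0 d1 Xx jP.
  have -> : f d = d ^+ L *: s d^-1 + 0 by rewrite addr0.
  rewrite Cp_derivD// frechet_deriv_cst0 addr0 normrZ.
  have -> : frechet_deriv (s d^-1) j x =
      frechet_deriv (fun x => cut_monomial (d^-1 *: (x - c))) j x.
    by apply: (frechet_deriv_eq_on oX) => // z Xz; rewrite Cp_restrictE.
  have := (S d^-1).2 j jP x Xx => /(ler_wpM2l (normr_ge0 (d ^+ L)))/le_trans; apply.
  have jL : (j < L)%N by exact: leq_ltn_trans PL.
  rewrite mulrA -(subnK (ltnW jL)) exprD normrM normfV normrX (normrX j d) -mulrA exprVn.
  have dj : `|d| ^+ j != 0 by rewrite expf_neq0// normr_eq0 gt_eqF.
  rewrite -mulrA (mulrA (`|d| ^+ j)) mulfV// mul1r (gtr0_norm d0).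
  apply: ler_pM => //; [by rewrite exprn_ge0 ?ltW| |exact: HM].
  have -> : (L - j = (L - j).-1.+1)%N by rewrite prednK// subn_gt0.
  by rewrite exprS ler_piMr ?exprn_ile1 ?(ltW d0).
have fcvg : f d @[d --> (0 : R)^'+] --> (0 : Cp (Some P) oX E).
  apply: Cp_cvg0 => K k e cK KX kP e0; near=> d => x j Kx jk.
  have d0 : 0 < d by near: d; exact: nbhs_right_gt.
  have d1 : d <= 1 by near: d; exact: nbhs_right_le.
  rewrite (le_trans (fder _ _ _ d0 d1 (KX _ Kx) (leq_trans jk kP)))//.
  have dM : d <= e / (M + 1) by near: d; apply: nbhs_right_le; rewrite divr_gt0// ltr_pwDr.
  rewrite (le_trans (ler_wpM2r M0 dM))// -mulrA ler_piMr ?(ltW e0)//.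
  by rewrite mulrC ler_pdivrMr ?ltr_pwDr// mul1r lerDl.
have Tfcvg : T (f d) y @[d --> (0 : R)^'+] --> (0 : F).
  have T0 : T (f d) @[d --> (0 : R)^'+] --> (0 : Cp q oY F).
    have T0 : {for (0 : Cp (Some P) oX E), continuous T} by exact: T_continuous.
    rewrite /prop_for /continuous_at linear0 in T0.
    exact: (cvg_comp _ _ fcvg T0).
  exact: (cvg_comp _ _ T0 (Cp_eval_continuous Yy)).
have Tgcvg : T (f d) y @[d --> (0 : R)^'+] --> T g y.
  apply: cvg_near_cst; near=> d; apply/esym/Tf; near: d; exact: nbhs_right_gt.
by apply: (cvg_unique _ Tgcvg Tfcvg); exact: norm_hausdorff.
Unshelve. all: by end_near. Qed.

End CutOff.

End Flatness.

(** * Norming functionals *)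
Section HahnBanach.
Context {R : realType} {F : normedModType R}.
Implicit Types A B : set (F * R).

(** Partial functionals are encoded by their graphs: if A is nonempty, it is a
    linear subspace of F * R, and the second condition at v = 0, applied to
    (0, r) and (0, -r), makes it the graph of a functional of norm at most 1 on
    a subspace of F. *)
Definition dominated A := [/\
  forall a x y, A x -> A y -> A (a *: x.1 + y.1, a * x.2 + y.2) &
  forall x, A x -> x.2 <= `|x.1|].

Lemma dominated_extend A v x0 : dominated A -> A x0 ->
  exists2 B, dominated B & A `<=` B /\ exists r, B (v, r).
Proof.
move=> [Al Ad] Ax0.
have A0 : A (0, 0).
  by have := Al (-1) x0 x0 Ax0 Ax0; rewrite scaleN1r mulN1r !addNr.
have AZ a x : A x -> A (a *: x.1, a * x.2).
  by move=> Ax; have := Al a x (0, 0) Ax A0; rewrite !addr0.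
pose S := [set x.2 - `|x.1 - v| | x in A].
have Sub y : A y -> ubound S (`|y.1 + v| - y.2).
  move=> Ay _ [x Ax <-].
  have := Ad _ (Al 1 x y Ax Ay); rewrite /= scale1r mul1r => xy.
  have : `|x.1 + y.1| <= `|x.1 - v| + `|y.1 + v|.
    by rewrite (le_trans _ (ler_normD _ _))// addrACA addNr addr0.
  by move: xy; lra.
have S0 : S !=set0 by exists (0 - `|0 - v|); exists (0, 0).
have hS : has_sup S by split=> //; eexists; exact: Sub A0.
(* Any c between the suprema of S and the bounds in Sub extends the
   functional by the value c at v. *)
pose c := sup S.
have cl x : A x -> x.2 - `|x.1 - v| <= c.
  by move=> Ax; apply: ub_le_sup; [exact: hS.2|exists x].
have cu y : A y -> c <= `|y.1 + v| - y.2.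
  by move=> Ay; apply: sup_le_ub => //; exact: Sub.
exists [set z | exists x t, A x /\ z = (x.1 + t *: v, x.2 + t * c)]; last first.
  split=> [x Ax|]; first by exists x, 0; rewrite scale0r mul0r !addr0 -surjective_pairing.
  by exists c, (0, 0), 1; rewrite /= scale1r mul1r !add0r.
split=> [a _ _ [x [t [Ax ->]]] [y [s [Ay ->]]]|_ [x [t [Ax ->]]]] /=.
  exists (a *: x.1 + y.1, a * x.2 + y.2), (a * t + s); split; first exact: Al.
  by rewrite scalerDr scalerDl -scalerA addrACA mulrDr mulrDl -(mulrA a) (addrACA (a * _)).
have [t0|t0|->] := ltgtP t 0; last by rewrite scale0r mul0r !addr0; exact: Ad.
  have := cl _ (AZ (- t)^-1 _ Ax); rewrite /= => /(ler_wpM2l (_ : 0 <= - t)).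
  have t0' : 0 < - t by rewrite oppr_gt0.
  move=> /(_ (ltW t0')); rewrite mulrBr mulrA mulfV ?gt_eqF// mul1r.
  rewrite -[X in X * `|_ - _|](gtr0_norm t0') -normrZ scalerBr scalerA mulfV ?gt_eqF//.
  by rewrite scale1r scaleNr opprK mulNr; lra.
have := cu _ (AZ t^-1 _ Ax); rewrite /= => /(ler_wpM2l (ltW t0)).
rewrite mulrBr mulrA mulfV ?gt_eqF// mul1r.
rewrite -[X in X * `|_ + _|](gtr0_norm t0) -normrZ scalerDr scalerA mulfV ?gt_eqF//.
by rewrite scale1r; lra.
Qed.

Lemma hahn_banach_functional (b : F) : b != 0 ->
  exists2 phi : F -> R^o, linear phi & (forall u, `|phi u| <= 1 * `|u|) /\ phi b != 0.
Proof.
move=> b0; pose A0 : set (F * R) := [set z | exists t, z = (t *: b, t * `|b|)].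
have dA0 : dominated A0.
  split=> [a _ _ [t ->] [s ->]|_ [t ->]] /=.
    by exists (a * t + s); rewrite scalerDl mulrDl scalerA mulrA.
  by rewrite normrZ ler_wpM2r// ler_norm.
have A0b : A0 (b, `|b|) by exists 1; rewrite scale1r mul1r.
(* The empty graph is admitted only because the empty chain must have an
   upper bound. *)
pose P A := A = set0 \/ dominated A /\ A (b, `|b|).
have [A [PA Amax]] : exists A, P A /\ forall B, A `<` B -> ~ P B.
  apply: Zorn_bigcup => C CP Ctot.
  have [[A CA Ab]|nA] := pselect (exists2 A, C A & A (b, `|b|)); last first.
    left; apply/seteqP; split=> // z [A CA Az].
    have [A_eq0|[_ Ab]] := CP _ CA; first by rewrite A_eq0 in Az.
    by case: nA; exists A.
  right; split; last by exists A.
  have CPd B z : C B -> B z -> dominated B.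
    by move=> CB Bz; have [B_eq0|[]//] := CP _ CB; rewrite B_eq0 in Bz.
  split=> [a x y [B CB Bx] [D CD Dy]|x [B CB Bx]].
    have [BD|DB] := Ctot _ _ CB CD.
      by exists D => //; have [+ _] := CPd _ _ CD Dy; apply => //; exact: BD.
    by exists B => //; have [+ _] := CPd _ _ CB Bx; apply => //; exact: DB.
  by have [_] := CPd _ _ CB Bx; exact.
have [dA Ab] : dominated A /\ A (b, `|b|).
  case: PA => // A_eq0; exfalso; apply: (Amax A0); last by right.
  by split; [rewrite A_eq0|move=> /(_ _ A0b); rewrite A_eq0].
have Atot v : exists r, A (v, r).
  have [B dB [AB [r Br]]] := dominated_extend v dA Ab.
  exists r; have [//|nAr] := pselect (A (v, r)); exfalso.
  apply: (Amax B); last by right; split=> //; exact: AB.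
  by split=> // BA; apply: nAr; exact: BA.
have Auniq v r s : A (v, r) -> A (v, s) -> r = s.
  move=> Ar As; have [Al Ad] := dA; apply/eqP; rewrite eq_le.
  have := Ad _ (Al (-1) _ _ Ar As); have := Ad _ (Al (-1) _ _ As Ar).
  rewrite /= scaleN1r addNr normr0 !mulN1r !(addrC (- _)) !subr_le0.
  by move=> -> ->.
have [phi phiP] := choice Atot.
have phiE v r : A (v, r) -> phi v = r by move=> Ar; exact: Auniq Ar.
exists phi; last split.
- move=> a u v; apply: phiE; have [Al _] := dA.
  exact: (Al a (u, phi u) (v, phi v) (phiP u) (phiP v)).
- move=> u; rewrite mul1r ler_norml; have [Al Ad] := dA.
  rewrite (Ad _ (phiP u)) andbT lerNl.
  have A00 := Al (-1) _ _ (phiP u) (phiP u).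
  have := Ad _ (Al (-1) _ _ (phiP u) A00).
  by rewrite /= !scaleN1r !mulN1r !addNr !addr0 normrN.
- by rewrite (phiE _ _ Ab) normr_eq0.
Qed.

End HahnBanach.

(** * Recovering a multiple root from a Hankel matrix *)
Section Hankel.
Context {K : fieldType} (m : nat) (s : K).
Variable l : {linear {poly K} -> K^o}.
Hypothesis l0 : forall Q, l (Q * ('X - s%:P) ^+ m.+1) = 0.

Definition hankel : 'M[K]_m.+1 := \matrix_(a, b) (l 'X^(a + b) : K).

(** A vector in the kernel is a polynomial Q of degree at most m with
    l(Q A) = 0 for all A of degree at most m.  If Q = (X - s)^r Q1 with
    Q1(s) <> 0, then A = (X - s)^(m - r) gives Q1(s) l((X - s)^m) = 0, since l
    kills the multiples of (X - s)^(m+1). *)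
Lemma hankel_unit : l (('X - s%:P) ^+ m) != 0 -> \det hankel != 0.
Proof.
move=> lm; apply/negP => /det0P[v v0 vH].
pose Q := rVpoly v.
have Q0 : Q != 0.
  by apply: contraNneq v0 => Q0; rewrite -(rVpolyK v) -/Q Q0 linear0.
have lX b : (b < m.+1)%N -> l (Q * 'X^b) = 0.
  move=> bm; have := congr1 (fun w : 'rV[K]_m.+1 => w ord0 (Ordinal bm)) vH.
  rewrite !mxE => E; rewrite -[RHS]E /Q /rVpoly poly_def mulr_suml linear_sum /=.
  apply: eq_bigr => a _; rewrite mxE insubT //= => am.
  by rewrite -scalerAl linearZ -exprD /GRing.scale /=; congr (v _ _ * _); apply/val_inj.
have lA (A : {poly K}) : (size A <= m.+1)%N -> l (Q * A) = 0.
  move=> sA; rewrite -(coefK A) poly_def mulr_sumr linear_sum big1// => b _.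
  by rewrite -scalerAr linearZ /= lX ?scaler0// (leq_trans (ltn_ord b)).
have [r [Q1]] := multiplicity_XsubC Q s; rewrite Q0 /= => Q1s QE.
have rm : (r <= m)%N.
  have Q10 : Q1 != 0 by apply: contraNneq Q0 => Q10; rewrite QE Q10 mul0r.
  have : (size Q <= m.+1)%N by exact: size_poly.
  rewrite QE size_Mmonic ?monic_exp ?monicXsubC// size_exp_XsubC addnS /=.
  move=> sQ; rewrite -ltnS (leq_trans _ sQ)//.
  by rewrite -add1n leq_add2r size_poly_gt0.
have := lA (('X - s%:P) ^+ (m - r)) _; rewrite size_exp_XsubC ltnS leq_subr => /(_ isT).
rewrite QE -mulrA -exprD subnKC//.
have /factor_theorem[Q2 Q2E] : root (Q1 - Q1.[s]%:P) s by rewrite rootE !hornerE subrr.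
rewrite -[Q1](subrK Q1.[s]%:P) Q2E mulrDl linearD /= -mulrA -exprS l0 add0r.
rewrite mul_polyC linearZ /= => /eqP; rewrite mulf_eq0 (negPf lm) orbF.
by apply/negP; rewrite -rootE.
Qed.

Lemma coef_XsubC_exp n : (('X - s%:P) ^+ n.+1)`_n = - (n.+1%:R * s).
Proof.
elim: n => [|n IH]; first by rewrite expr1 coefB coefX coefC /= sub0r mul1r.
rewrite exprS mulrBl coefB coefXM coefCM /= IH.
have := monicP (monic_exp n.+1 (monicXsubC s)).
rewrite /lead_coef size_exp_XsubC /= => ->.
by rewrite mulr1 -opprD -[X in - (_ + X)]mul1r -mulrDl natr1.
Qed.

(** The equations l(X^a (X - s)^(m+1)) = 0 for a <= m form a linear system with
    the Hankel matrix for the lower coefficients of (X - s)^(m+1), and (m+1) s is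
    minus the coefficient of X^m. *)
Lemma hankel_root :
  \det hankel * (m.+1%:R * s) = \sum_a \adj hankel ord_max a * (l 'X^(a + m.+1) : K).
Proof.
pose c : 'cV[K]_m.+1 := \col_b (('X - s%:P) ^+ m.+1)`_b.
pose tau : 'cV[K]_m.+1 := \col_a (l 'X^(a + m.+1) : K).
have Hc : hankel *m c = - tau.
  apply/matrixP => a j; rewrite !mxE.
  have := l0 'X^a; set D := ('X - s%:P) ^+ m.+1.
  have DE : D = 'X^(m.+1) + \sum_(b < m.+1) D`_b *: 'X^b.
    have := monicP (monic_exp m.+1 (monicXsubC s)); rewrite -/D /lead_coef.
    rewrite {1}/D size_exp_XsubC /= => D1.
    rewrite -[LHS]coefK poly_def {1}/D size_exp_XsubC big_ord_recr /= D1 scale1r.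
    by rewrite addrC.
  rewrite {1}DE mulrDr linearD /= -exprD mulr_sumr linear_sum /= => /eqP.
  rewrite addrC addr_eq0 => /eqP <-; apply: eq_bigr => b _.
  by rewrite !mxE -scalerAr -exprD linearZ /= mulrC.
have := congr1 (fun B : 'cV[K]_m.+1 => B ord_max ord0)
  (congr1 (mulmx (\adj hankel)) Hc).
rewrite mulmxA mul_adj_mx mul_scalar_mx mulmxN !mxE coef_XsubC_exp mulrN.
move=> /oppr_inj ->; by apply: eq_bigr => a _; rewrite [tau _ _]mxE.
Qed.

End Hankel.

(** * Regularity of the support map *)
Section PolynomialValues.
Context {R : realType} {H E F : normedModType R} {n q : nat} {p : option nat}.
Local Notation V := 'rV[R]_n.
Context {X : set V} {oX : open X} {Y : set H} {oY : open Y}.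
Variable T : {linear Cp p oX E -> Cp (Some q) oY F}.
Hypothesis T_continuous : continuous T.
Variable (h : H -> V).
Hypothesis h_support : is_support_map T h.

Lemma monomial_eq0_above_order lam (u : E) y (Cg : is_Cp p X
    (fun x => (\prod_i (x ord0 i - h y ord0 i) ^+ lam i) *: u)) :
  Y y -> ~~ le_ord (\sum_(i < n) lam i)%N p -> T (Cp_restrict oX Cg) y = 0.
Proof.
case: p T T_continuous h_support Cg => [P|//] T' Tc hs Cg Yy PL.
by apply: (monomial_eq0_finite_order Tc hs); rewrite ?ltnNge.
Qed.

Variable u : E.

(** The value at y of T on the function g u, made total in g by the default 0
    when g u is not of class C^p, so that it can be applied to arbitrary
    expressions and compared by extensionality. *)
Definition Tscal y (g : V -> R) : F :=
  match pselect (is_Cp p X (fun x => g x *: u)) with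
  | left C => T (Cp_restrict oX C) y
  | right _ => 0
  end.

Lemma TscalE y g (C : is_Cp p X (fun x => g x *: u)) :
  Tscal y g = T (Cp_restrict oX C) y.
Proof.
rewrite /Tscal; case: pselect => // C'; congr (Cp_fun (T _) y).
by apply: CpP => x Xx; rewrite !Cp_restrictE.
Qed.

Lemma is_Cp_scaleu (g : V -> R^o) : is_Cp p X g -> is_Cp p X (fun x => (g x : R) *: u).
Proof. exact: (is_Cp_post (scaleu_linear u) (scaleu_bound u) oX). Qed.

Lemma Tscal_linear y a (f g : V -> R^o) : is_Cp p X f -> is_Cp p X g ->
  Tscal y (fun x => a * f x + g x) = a *: Tscal y f + Tscal y g.
Proof.
move=> Cf Cg.
have Cfg : is_Cp p X (fun x => a * f x + g x : R^o) by exact: (is_Cp_linear a oX Cf Cg).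
rewrite (TscalE _ (is_Cp_scaleu Cfg)) (TscalE _ (is_Cp_scaleu Cf))
  (TscalE _ (is_Cp_scaleu Cg)).
set f' := Cp_restrict _ (is_Cp_scaleu Cf); set g' := Cp_restrict _ (is_Cp_scaleu Cg).
rewrite -[RHS]/((a *: T f' + T g') y) -linearP; congr (Cp_fun (T _) y).
apply: CpP => x Xx; rewrite Cp_restrictE// -[RHS]/(a *: f' x + g' x) !Cp_restrictE//.
by rewrite scalerDl scalerA.
Qed.

Lemma Tscal_is_Cp g : is_Cp p X (fun x => g x *: u) -> is_Cp (Some q) Y (Tscal^~ g).
Proof.
move=> C; rewrite (_ : Tscal^~ g = T (Cp_restrict oX C)); first exact: Cp_is_Cp.
by apply/funext => y; rewrite (TscalE _ C).
Qed.

Definition shifted_mono (lam : 'I_n -> nat) (c x : V) : R :=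
  \prod_i (x ord0 i - c ord0 i) ^+ lam i.

Lemma shifted_mono_is_Cp lam c : is_Cp p X (shifted_mono lam c : V -> R^o).
Proof. exact: monomial_is_Cp. Qed.

Lemma Phi_mono y lam : Phi T h y (mono_form lam u) =
  (\sum_(i < n) lam i)`!%:R^-1 *: Tscal y (shifted_mono lam (h y)).
Proof.
rewrite (TscalE _ (is_Cp_scaleu (shifted_mono_is_Cp lam (h y)))) /Phi.
congr (_ *: Cp_fun (T _) y).
apply: CpP => x Xx; rewrite !Cp_restrictE// mono_formE; congr (_ *: _).
by apply: eq_bigr => i _; rewrite !mxE.
Qed.

Lemma Phi_mono_eq0 y lam :
  Phi T h y (mono_form lam u) = 0 <-> Tscal y (shifted_mono lam (h y)) = 0.
Proof.
rewrite Phi_mono; split=> [/eqP|->]; last by rewrite scaler0.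
rewrite scaler_eq0 invr_eq0 pnatr_eq0 gtn_eqF ?fact_gt0//= => /eqP.
by [].
Qed.

Section Annihilation.
Variables (i : 'I_n) (m0 : nat) (y : H).
Hypothesis Yy : Y y.
Hypothesis Phi0 : forall lam, le_ord (\sum_(j < n) lam j)%N p -> (m0 < lam i)%N ->
  Phi T h y (mono_form lam u) = 0.

(** Multiplying by the monomials in x - h(y) before applying T makes this
    property stable under multiplication by any coordinate function. *)
Definition annihilated (g : V -> R^o) := is_Cp p X g /\
  forall lam, (m0 < lam i)%N -> Tscal y (fun x => shifted_mono lam (h y) x * g x) = 0.

Lemma annihilated1 : annihilated (fun=> 1).
Proof.
split=> [|lam lam_i]; first exact: is_Cp_cst.
rewrite (_ : (fun x => _) = shifted_mono lam (h y)); last by apply/funext => x; rewrite mulr1.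
have [lp|lp] := boolP (le_ord (\sum_(j < n) lam j)%N p).
  by apply/Phi_mono_eq0/Phi0.
rewrite (TscalE _ (is_Cp_scaleu (shifted_mono_is_Cp lam (h y)))).
exact: monomial_eq0_above_order.
Qed.

Lemma annihilated_linear a f g :
  annihilated f -> annihilated g -> annihilated (fun x => a * f x + g x).
Proof.
move=> [Cf f0] [Cg g0]; split=> [|lam lam_i]; first exact: (is_Cp_linear a oX Cf Cg).
rewrite (_ : (fun x => _) = (fun x =>
    a * (shifted_mono lam (h y) x * f x) + shifted_mono lam (h y) x * g x)).
  by rewrite Tscal_linear ?f0 ?g0 ?scaler0 ?addr0//; apply: is_CpM => //; exact: shifted_mono_is_Cp.
by apply/funext => x; rewrite mulrDr mulrCA.
Qed.

(** x_j - d = (x_j - h_j(y)) + (h_j(y) - d), and multiplication by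
    x_j - h_j(y) only raises the multiindex. *)
Lemma annihilated_coord j d g : annihilated g ->
  annihilated (fun x : V => (x ord0 j - d) * g x).
Proof.
move=> [Cg g0]; split=> [|lam lam_i]; first by apply: is_CpM => //; exact: is_Cp_coord.
pose lam' k := (lam k + (k == j))%N.
rewrite (_ : (fun x => _) = (fun x => (h y ord0 j - d) * (shifted_mono lam (h y) x * g x) +
    shifted_mono lam' (h y) x * g x)).
  rewrite Tscal_linear; [|apply: is_CpM => //; exact: shifted_mono_is_Cp..].
  by rewrite !g0 ?scaler0 ?addr0// ltn_addr.
apply/funext => x.
have -> : shifted_mono lam' (h y) x = (x ord0 j - h y ord0 j) * shifted_mono lam (h y) x.
  rewrite /shifted_mono /lam' [LHS](bigD1 j)// [in RHS](bigD1 j)//= eqxx addn1 exprS -mulrA.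
  congr (_ * (_ * _)); apply: eq_bigr => k /negPf ->; by rewrite addn0.
by ring.
Qed.

Lemma annihilated_mono nu c g : annihilated g ->
  annihilated (fun x => shifted_mono nu c x * g x).
Proof.
move=> ag; rewrite /shifted_mono.
suff Hr r : annihilated (fun x : V =>
  (\prod_(j <- r) (x ord0 j - c ord0 j) ^+ nu j) * g x) by [].
elim: r => [|j r IH].
  by rewrite (_ : (fun x => _) = g)//; apply/funext => x; rewrite big_nil mul1r.
rewrite (_ : (fun x => _) = (fun x : V => (x ord0 j - c ord0 j) ^+ nu j *
    ((\prod_(j <- r) (x ord0 j - c ord0 j) ^+ nu j) * g x))); last first.
  by apply/funext => x; rewrite big_cons mulrA.
elim: (nu j) => [|k IHk].
  by under eq_fun do rewrite expr0 mul1r.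
by under eq_fun do rewrite exprS -mulrA; exact: annihilated_coord.
Qed.

Lemma annihilated_poly (Q : {poly R}) g :
  annihilated g -> annihilated (fun x => Q.[x ord0 i] * g x).
Proof.
move=> ag; elim/poly_ind: Q => [|Q c IH].
  rewrite (_ : (fun x => _) = (fun x => (-1) * g x + g x)); first exact: annihilated_linear.
  by apply/funext => x; rewrite horner0 mul0r mulN1r addNr.
rewrite (_ : (fun x => _) = (fun x : V =>
    c * g x + (x ord0 i - 0) * (Q.[x ord0 i] * g x))).
  by apply: annihilated_linear => //; exact: annihilated_coord.
apply/funext => x; rewrite hornerD hornerMX hornerC subr0 mulrDl addrC; congr (_ + _).
by rewrite mulrAC mulrC.
Qed.

End Annihilation.

End PolynomialValues.

Section CoordinateRegularity.
Context {R : realType} {H E F : normedModType R} {n q : nat} {p : option nat}.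
Local Notation V := 'rV[R]_n.
Context {X : set V} {oX : open X} {Y : set H} {oY : open Y}.
Variable T : {linear Cp p oX E -> Cp (Some q) oY F}.
Hypothesis T_continuous : continuous T.
Variable (h : H -> V).
Hypothesis h_support : is_support_map T h.
Variables (i : 'I_n) (m0 : nat) (W : set H) (y0 : H).
Hypotheses (oW : open W) (WY : W `<=` Y) (Wy0 : W y0).
Hypothesis Phi0 : forall y u lam, W y ->
  le_ord (\sum_(j < n) lam j)%N p -> (m0 < lam i)%N -> Phi T h y (mono_form lam u) = 0.
Variables (mu : 'I_n -> nat) (u : E).
Hypotheses (mui : mu i = m0) (Phi_neq0 : Phi T h y0 (mono_form mu u) <> 0).

Let w : V -> R^o := shifted_mono (fun j => if j == i then 0%N else mu j) (h y0).

Let ann_poly y Q : W y -> annihilated T h u i m0 y (fun x => Q.[x ord0 i] * w x).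
Proof.
move=> Wy; apply: annihilated_poly.
have := annihilated1 T_continuous h_support (WY Wy) (fun lam => @Phi0 y u lam Wy).
move=> /(annihilated_mono (fun j => if j == i then 0%N else mu j) (h y0)).
by under eq_fun do rewrite mulr1.
Qed.

Let Cw (Q : {poly R}) : is_Cp p X (fun x => Q.[x ord0 i] * w x : R^o).
Proof. by have [] := ann_poly Q Wy0. Qed.

(** [hankel_root] applies at every y in W and writes D(y) (m0 + 1) h_i(y) = N(y),
    where D and N are polynomials in values of T on functions that do not depend
    on y; D is not 0 at y0 by [hankel_unit], hence near y0 by continuity. *)
Lemma locally_is_Cp_coord : exists W', [/\ open W', W' y0 &
  is_Cp (Some q) W' (fun y => h y ord0 i : R^o)].
Proof.
pose ev y (Q : {poly R}) : F := Tscal T u y (fun x => Q.[x ord0 i] * w x).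
(* The factor w carries the exponents mu_j, j <> i, and the power of X - s
   carries mu_i = m0. *)
have b0 : ev y0 (('X - (h y0 ord0 i)%:P) ^+ m0) != 0.
  apply/eqP => ev0; apply: Phi_neq0; apply/Phi_mono_eq0; rewrite -[RHS]ev0.
  congr (Tscal T u y0 _); apply/funext => x.
  rewrite !hornerE /w /shifted_mono (bigD1 i)// [in RHS](bigD1 i)//= eqxx expr0 mul1r mui.
  by congr (_ * _); apply: eq_bigr => j /negPf ->.
have [phi phil [phib phi0]] := hahn_banach_functional b0.
have evl y a Q Q' : ev y (a *: Q + Q') = a *: ev y Q + ev y Q'.
  rewrite -Tscal_linear; [|exact: Cw..]; congr (Tscal T u y _); apply/funext => x.
  by rewrite hornerD hornerZ mulrDl -mulrA.
have ll y : linear (fun Q => phi (ev y Q) : R^o) by move=> a Q Q'; rewrite evl phil.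
pose lM y := GRing.isLinear.Build _ _ _ _ _ (ll y).
pose l y : {linear {poly R} -> R^o} := HB.pack (fun Q => phi (ev y Q) : R^o) (lM y).
have lC Q : is_Cp (Some q) Y (fun y => l y Q).
  apply: (is_Cp_post phil phib oY); apply: Tscal_is_Cp; exact: is_Cp_scaleu (Cw Q).
have l0 y : W y -> forall Q, l y (Q * ('X - (h y ord0 i)%:P) ^+ m0.+1) = 0.
  move=> Wy Q.
  have [_ /(_ (fun j => if j == i then m0.+1 else 0%N))] := ann_poly Q Wy.
  rewrite eqxx => /(_ (ltnSn _)) E0.
  suff : ev y (Q * ('X - (h y ord0 i)%:P) ^+ m0.+1) = 0.
    by rewrite /l /= => ->; have := phil (-1) 0 0; rewrite !scaler0 addr0 scaleN1r addNr.
  rewrite -[RHS]E0; congr (Tscal T u y _); apply/funext => x.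
  rewrite hornerM horner_exp hornerXsubC mulrCA mulrA; congr (_ * _ * _).
  rewrite /shifted_mono (bigD1 i)//= eqxx big1 ?mulr1// => j /negPf ->.
  by rewrite expr0.
pose A y := hankel m0 (l y).
have AC a b : is_Cp (Some q) Y (fun y => A y a b : R^o).
  by apply: is_Cp_eq (lC 'X^(a + b)) => // y _; rewrite mxE.
pose D y : R^o := \det (A y).
pose N y : R^o := \sum_a \adj (A y) ord_max a * (l y 'X^(a + m0.+1) : R).
have DC : is_Cp (Some q) Y D by exact: is_Cp_det.
have NC : is_Cp (Some q) Y N.
  apply: is_Cp_sum => // a; apply: is_CpM => //.
  apply: (@is_Cp_eq _ _ _ _ _ (fun y => (-1) ^+ (a + ord_max) *
      \det (row' a (col' ord_max (A y))) : R^o)) => //.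
    by move=> y _; rewrite mxE.
  apply: is_CpM => //; first exact: is_Cp_cst.
  apply: is_Cp_det => // b c.
  by apply: is_Cp_eq (AC (lift a b) (lift ord_max c)) => // y _; rewrite !mxE.
have D0 : D y0 != 0 by apply: (hankel_unit (l0 _ Wy0)); exact: phi0.
pose W' := W `&` [set y | D y != 0].
have oW' : open W'.
  rewrite openE => y [Wy Dy]; apply: filterI; first exact: open_nbhs_nbhs.
  have Dc := is_Cp_cont0 oY DC (WY Wy).
  exact: (cvgr_neq0 _ Dc).
exists W'; split=> //.
have W'Y : W' `<=` Y by move=> y [/WY].
apply: (@is_Cp_eq _ _ _ _ _ (fun y => ((D y * m0.+1%:R : R) ^-1 *: N y))) => //; last first.
  apply: (@is_Cp_quotient _ _ _ q W' (fun y => D y * m0.+1%:R : R^o)) => //.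
  - apply: is_CpM => //; last exact: is_Cp_cst.
    exact: is_Cp_sub DC.
  - exact: is_Cp_sub NC.
  - by move=> y [_ Dy]; rewrite mulf_neq0// pnatr_eq0.
move=> y [Wy Dy]; rewrite /N -(hankel_root (l0 _ Wy)) mulrA /GRing.scale /=.
by rewrite mulKf// mulf_neq0// pnatr_eq0.
Qed.

End CoordinateRegularity.

Section Assembly.
Context {R : realType} {H : normedModType R} {n : nat}.

Lemma open_dense_inter (Y : set H) (U : 'I_n -> set H) : open Y ->
  (forall i, open (U i)) -> (forall i, Y `<=` closure (U i)) ->
  open (Y `&` \bigcap_(i in [set: 'I_n]) U i) /\
  Y `<=` closure (Y `&` \bigcap_(i in [set: 'I_n]) U i).
Proof.
move=> oY oU dU; pose A (r : seq 'I_n) := Y `&` [set y | forall i, i \in r -> U i y].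
have -> : Y `&` \bigcap_(i in [set: 'I_n]) U i = A (enum 'I_n).
  apply/seteqP; split=> y [Yy Uy]; split=> // i _; first exact: Uy.
  by apply: Uy; rewrite mem_enum.
have AS i r : A (i :: r) = A r `&` U i.
  apply/seteqP; split=> y.
    move=> [Yy Uy]; split; last exact: Uy (mem_head _ _).
    by split=> // j jr; apply: Uy; rewrite in_cons jr orbT.
  by move=> [[Yy Uy] Uiy]; split=> // j; rewrite in_cons => /orP[/eqP->//|/Uy].
elim: (enum _) => [|i r [oA dA]].
  have -> : A [::] = Y by apply/seteqP; split=> [y []//|y Yy]; split.
  by split=> //; exact: subset_closure.
rewrite AS; split=> [|y Yy B]; first exact: openI.
rewrite nbhsE => -[C [oC Cy] CB].
have [z [Az Cz]] := dA _ Yy _ (open_nbhs_nbhs (conj oC Cy)).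
have [t [Ut [At Ct]]] : U i `&` (A r `&` C) !=set0.
  by apply: (dU i z Az.1); apply: open_nbhs_nbhs; split=> //; exact: openI.
by exists t; split=> //; exact: CB.
Qed.

Lemma is_Cp_rV p (X : set H) (f : H -> 'rV[R]_n) : open X ->
  (forall i, is_Cp p X (fun y => f y ord0 i : R^o)) -> is_Cp p X f.
Proof.
move=> oX Cf.
apply: (@is_Cp_eq _ _ _ _ _ (fun y =>
  \sum_i (f y ord0 i : R) *: (delta_mx 0 i : 'rV[R]_n))) => //.
  by move=> y _; rewrite -row_sum_delta.
apply: is_Cp_sum => // i.
exact: (is_Cp_post (scaleu_linear _) (scaleu_bound _) oX (Cf i)).
Qed.

End Assembly.

Theorem proposition29 (R : realType) (H E F : completeNormedModType R) (n : nat)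
    (X : set 'rV[R]_n) (oX : open X) (Y : set H) (oY : open Y)
    (q : nat) (p : option nat) (qp : lt_ord q p)
    (T : {linear Cp p oX E -> Cp (Some q) oY F})
    (T_continuous : continuous T)
    (T_separating : separating T)
    (T_nowhere_trivial : nowhere_trivial T)
    (h : H -> 'rV[R]_n) (h_support : is_support_map T h)
    (U : 'I_n -> set H)
    (U_open : forall i, open (U i))
    (U_sub : forall i, U i `<=` Y)
    (U_dense : forall i, Y `<=` closure (U i))
    (U_prop : forall (i : 'I_n) (y0 : H), U i y0 ->
       exists (m0 : nat) (V : set H),
         [/\ open V, V `<=` Y, V y0,
             forall (y : H) (u : E) (lam : 'I_n -> nat), V y ->
               le_ord (\sum_(j < n) lam j)%N p -> (m0 < lam i)%N ->
               Phi T h y (mono_form lam u) = 0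
           & exists (mu : 'I_n -> nat) (u : E),
               [/\ le_ord (\sum_(j < n) mu j)%N p, mu i = m0
                 & Phi T h y0 (mono_form mu u) <> 0]]) :
  (forall i : 'I_n, is_Cp (Some q) (U i) (fun y : H => h y ord0 i : R^o)) /\
  (let U0 := Y `&` \bigcap_(i in [set: 'I_n]) U i in
   [/\ open U0, Y `<=` closure U0 & is_Cp (Some q) U0 h]).
Proof.
have Ch i : is_Cp (Some q) (U i) (fun y : H => h y ord0 i : R^o).
  apply: is_Cp_local => // y0 Uy0.
  have [m0 [V [oV VY Vy0 Phi0 [mu [u [_ mui Phi_neq0]]]]]] := U_prop i y0 Uy0.
  have [W [oW Wy0 CW]] :=
    locally_is_Cp_coord T_continuous h_support oV VY Vy0 Phi0 mui Phi_neq0.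
  by exists W.
split=> //=; have [oU0 dU0] := open_dense_inter oY U_open U_dense.
split=> //; apply: is_Cp_rV => // i.
by apply: is_Cp_sub (Ch i) => // y [_]; exact.
Qed.
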